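(* There is a constant $L$ such that $\pi(\mathcal{C}_\ell^-) = 1/4$ for every integer $\ell > L$ not divisible by $3$.
   Context: A $3$-graph is a $3$-uniform hypergraph. For $\ell\ge 4$, the tight cycle $\mathcal{C}_\ell$ is the $3$-graph on vertex set $\{0,1,\ldots,\ell-1\}$ with hyperedges $\{i,i+1,i+2\}$ (indices mod $\ell$), $0\le i\le \ell-1$; $\mathcal{C}_\ell^-$ is obtained from $\mathcal{C}_\ell$ by removing the hyperedge $\{\ell-1,0,1\}$. For a family $\mathbf{F}$ of $3$-graphs, $\mathrm{ex}(n,\mathbf{F})$ is the maximum number of hyperedges in an $n$-vertex $3$-graph containing no member of $\mathbf{F}$ as a (not necessarily induced) subhypergraph, and the Turán density is $\pi(\mathbf{F})=\lim_{n\to\infty}\mathrm{ex}(n,\mathbf{F})/\binom{n}{3}$; for a single $3$-graph $\mathcal{F}$, $\pi(\mathcal{F})=\pi(\{\mathcal{F}\})$. *)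

(* Defs.v *)
From HB Require Import structures.
From mathcomp Require Import all_boot all_order all_algebra.
From mathcomp Require Import all_classical all_reals all_analysis.
From mathcomp Require Import zify.

Set Implicit Arguments.
Unset Strict Implicit.
Unset Printing Implicit Defensive.

Import Order.TTheory GRing.Theory Num.Theory.
Import numFieldNormedType.Exports.

Local Open Scope ring_scope.

Definition uniform3 (V : finType) (E : {set {set V}}) : bool :=
  [forall e in E, #|e| == 3].

Definition graph3 (V : finType) : Type := {E : {set {set V}} | uniform3 E}.

Definition edges (V : finType) (G : graph3 V) : {set {set V}} := sval G.

(* Not necessarily induced: only the edges of [F] have to be preserved. *)
Definition contains (V W : finType) (H : graph3 V) (F : graph3 W) : Prop :=
  exists f : W -> V,
    injective f /\ forall e, e \in edges F -> f @: e \in edges H.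

Definition family3 : Type := {V : finType & graph3 V} -> Prop.

Definition family_free (V : finType) (Fs : family3) (H : graph3 V) : Prop :=
  forall F, Fs F -> ~ contains H (projT2 F).

Definition ex (n : nat) (Fs : family3) : nat :=
  \max_(H : graph3 'I_n | `[< family_free Fs H >]) #|edges H|.

Definition turan_ratio (R : realType) (Fs : family3) (n : nat) : R :=
  (ex n Fs)%:R / 'C(n, 3)%:R.

(* The limit always exists, see [is_cvg_turan_ratio] below. *)
Definition family_turan_density (R : realType) (Fs : family3) : R :=
  lim (turan_ratio R Fs @ \oo)%classic.

Definition turan_density (R : realType) (V : finType) (F : graph3 V) : R :=
  family_turan_density R (fun G => G = existT graph3 V F).

(* [ordS] is the successor modulo [l]. *)
Definition tight_cycle_edges (l : nat) : {set {set 'I_l}} :=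
  [set [set i; ordS i; ordS (ordS i)] | i : 'I_l].

Definition tight_cycle_minus_edges (l : nat) : {set {set 'I_l}} :=
  tight_cycle_edges l :\ [set x : 'I_l | val x \in [:: l.-1; 0; 1]%N].

Lemma tight_cycle_uniform3 (l : nat) :
  (4 <= l)%N -> uniform3 (tight_cycle_edges l).
Proof.
move=> hl; apply/forall_inP => e /imsetP[i _ ->].
have modS (k : nat) : (k < l)%N -> (k.+1 %% l = if k.+1 == l then 0 else k.+1)%N.
  by move=> kl; case: eqP => [->|/eqP ne]; rewrite ?modnn // modn_small // ltn_neqAle ne.
have h1 := modS i (ltn_ord i); have h2 := modS (ordS i) (ltn_ord (ordS i)).
have hi := ltn_ord i.
have [n01 n02 n12] : [/\ i != ordS i, i != ordS (ordS i) & ordS i != ordS (ordS i)].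
  move: h2; rewrite -!val_eqE /= h1 => ->.
  by split; case: (eqVneq i.+1 l) => ?; try case: (eqVneq _ l) => ?; lia.
by rewrite -finset.setUA !cardsU1 cards1 !inE negb_or n01 n02 n12.
Qed.

Lemma tight_cycle_minus_uniform3 (l : nat) :
  (4 <= l)%N -> uniform3 (tight_cycle_minus_edges l).
Proof.
move=> hl; apply/forall_inP => e; rewrite !inE => /andP[_ he].
by move/forall_inP: (tight_cycle_uniform3 hl) => ->.
Qed.

Definition tight_cycle (l : nat) (hl : (4 <= l)%N) : graph3 'I_l :=
  exist _ (tight_cycle_edges l) (tight_cycle_uniform3 hl).

Definition tight_cycle_minus (l : nat) (hl : (4 <= l)%N) : graph3 'I_l :=
  exist _ (tight_cycle_minus_edges l) (tight_cycle_minus_uniform3 hl).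

Lemma removed_edge_in_tight_cycle (l : nat) : (4 <= l)%N ->
  [set x : 'I_l | val x \in [:: l.-1; 0; 1]%N] \in tight_cycle_edges l.
Proof.
case: l => // l hl; apply/imsetP; exists ord_max => //.
apply/setP => x; rewrite !inE -!val_eqE /= modnn modn_small ?orbA //.
exact: leq_trans hl.
Qed.

Lemma ex_averaging (n : nat) (Fs : family3) :
  (ex n.+1 Fs * (n.+1 - 3) <= n.+1 * ex n Fs)%N.
Proof.
rewrite /ex; apply: (big_ind (fun m => (m * (n.+1 - 3) <= n.+1 * ex n Fs)%N)).
- by rewrite mul0n.
- by move=> a b ha hb; rewrite maxnMl geq_max ha hb.
move=> [H Hu] /asboolP Hfree; rewrite /edges /=.
have Hu3 e : e \in H -> #|e| = 3 by move=> eH; apply/eqP; have /forall_inP := Hu; apply.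
pose D (v : 'I_n.+1) : {set {set 'I_n}} := [set e : {set 'I_n} | lift v @: e \in H].
have Du v : uniform3 (D v).
  apply/forall_inP => e; rewrite inE => /Hu3 <-.
  by rewrite card_imset //; exact: lift_inj.
have Dex v : (#|D v| <= ex n Fs)%N.
  apply: (@leq_bigmax_cond _ _ (fun K : graph3 'I_n => #|edges K|) (exist _ (D v) (Du v))).
  apply/asboolP => F FF [f [finj fE]]; apply: (Hfree F FF).
  exists (lift v \o f); split; first by move=> x y /= /lift_inj /finj.
  by move=> e /fE; rewrite /edges /= inE (imset_comp (lift v) f).
have Dcard v : #|D v| = (\sum_(e in H) (v \notin e))%N.
  rewrite -sum1_card [RHS](eq_bigr (fun e : {set 'I_n.+1} => if v \notin e then 1%N else 0%N)); last first.
    by move=> e _; case: (v \notin e).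
  rewrite -big_mkcondr sum1_card sum1_card.
  rewrite -(card_imset (mem (D v)) (imset_inj (@lift_inj _ v))).
  apply: eq_card => e; apply/imsetP/andP => [[e' ]|[eH ve]].
    rewrite inE => e'H ->; split=> //; apply/imsetP => -[x _ /eqP].
    by rewrite (negbTE (neq_lift _ _)).
  have Ee : lift v @: [set x | lift v x \in e] = e.
    apply/setP => y; apply/imsetP/idP => [[x]|ye]; first by rewrite inE => ? ->.
    have [x Ex|Ey] := unliftP v y; first by exists x => //; rewrite inE -Ex.
    by rewrite -Ey ye in ve.
  by exists [set x | lift v x \in e]; rewrite ?inE Ee.
have -> : (#|H| * (n.+1 - 3) = \sum_(v < n.+1) #|D v|)%N.
  under eq_bigr do rewrite Dcard.
  rewrite exchange_big /= -sum_nat_const; apply: eq_bigr => e /Hu3 e3.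
  have -> : (n.+1 - 3 = #|~: e|)%N.
    by have := cardsC e; rewrite card_ord e3 => E; lia.
  rewrite -sum1_card big_mkcond /=.
  by apply: eq_bigr => v _; rewrite inE; case: (v \in e).
rewrite -[X in (_ <= X * _)%N]card_ord -sum_nat_const.
by apply: leq_sum => v _.
Qed.

Lemma is_cvg_turan_ratio (R : realType) (Fs : family3) :
  cvgn (turan_ratio R Fs).
Proof.
suff /cvg_ex[a ha] : cvgn (fun n => turan_ratio R Fs (n + 3)).
  by apply/cvg_ex; exists a; rewrite -(cvg_shiftn 3).
apply: nonincreasing_is_cvgn; last first.
  by exists 0 => _ [n _ <-]; rewrite /turan_ratio divr_ge0.
apply/nonincreasing_seqP => n; rewrite /turan_ratio /= addSn.
set m := (n + 3)%N.
have c0 : (0 < 'C(m, 3))%N by rewrite bin_gt0 leq_addl.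
have c1 : (0 < 'C(m.+1, 3))%N by rewrite bin_gt0 ltnW // ltnS leq_addl.
rewrite ler_pdivrMr ?ltr0n // mulrAC ler_pdivlMr ?ltr0n // -!natrM ler_nat.
have key := ex_averaging m Fs.
have k0 : (0 < m.+1 - 3)%N by rewrite subn_gt0 ltnS leq_addl.
rewrite -(leq_pmul2r k0) mulnAC.
have E : ('C(m.+1, 3) * (m.+1 - 3) = m.+1 * 'C(m, 3))%N.
  by rewrite mulnC -mul_bin_down.
by rewrite -[X in (_ <= X)%N]mulnA E mulnCA mulnA leq_mul2r key orbT.
Qed.

(* Main.v *)
Require Import Defs.
From mathcomp Require Import all_boot all_order all_algebra.
From mathcomp Require Import all_classical all_reals all_analysis.
From mathcomp Require Import ring lra zify.
Set Implicit Arguments.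
Unset Strict Implicit.
Unset Printing Implicit Defensive.
Import Order.TTheory GRing.Theory Num.Theory.
Import numFieldNormedType.Exports.
Local Open Scope ring_scope.

(** A closed tight walk is bad if its length is not divisible by 3. [C_l^-] maps
    homomorphically to every 3-graph with a short bad closed walk: spinning around an edge
    lengthens a walk by 3, and undoing a step takes two steps. In a 3-graph without short bad
    closed walks, after deleting the edges on pairs of small codegree, the tight components have
    bounded diameter; hence each is tripartite, and they colour the pairs disjointly. Counting
    the monochromatic corners of triples bounds the number of monochromatic triangles by
    [n^3/24], and near-equality forces one component that is almost complete tripartite with
    parts of size about [n/3]. When all degrees are at least [n^2/8], every vertex then has a
    well-defined part, and the edges violating the tripartition are outnumbered by the missing
    crossing triples; so [e(H) <= abc + e(H[A]) + e(H[B]) + e(H[C])], and induction gives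
    [e(H) <= n^3/24 + O(n^2)]. Sampling and Erdős' box theorem transfer the bound from
    homomorphism-free to [C_l^-]-free 3-graphs. The iterated complete tripartite construction
    gives the lower bound. *)

(** * Averages and densities *)

Section Average.
Variables (R : realFieldType) (T : finType).
Implicit Types (f g : T -> R) (P Q S : pred T).

Definition avg f : R := (\sum_x f x) / #|T|%:R.

Definition density P : R := avg (fun x => (P x)%:R).

Lemma eq_avg f g : f =1 g -> avg f = avg g.
Proof. by move=> fg; rewrite /avg; under eq_bigr do rewrite fg. Qed.

Lemma avgD f g : avg (fun x => f x + g x) = avg f + avg g.
Proof. by rewrite /avg big_split mulrDl. Qed.

Lemma avgB f g : avg (fun x => f x - g x) = avg f - avg g.
Proof. by rewrite /avg big_split mulrDl sumrN mulNr. Qed.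

Lemma avgZl a f : avg (fun x => a * f x) = a * avg f.
Proof. by rewrite /avg -mulr_sumr mulrA. Qed.

Lemma avgZr a f : avg (fun x => f x * a) = avg f * a.
Proof. by rewrite /avg -mulr_suml mulrAC. Qed.

Lemma avg_sum (I : finType) (A : pred I) (F : I -> T -> R) :
  avg (fun x => \sum_(i | A i) F i x) = \sum_(i | A i) avg (F i).
Proof. by rewrite /avg exchange_big mulr_suml. Qed.

Lemma avg0 : avg (fun=> 0) = 0.
Proof. by rewrite /avg big1 ?mul0r. Qed.

Lemma avg_cst a : (0 < #|T|)%N -> avg (fun=> a) = a.
Proof.
move=> T0; rewrite /avg sumr_const -[a *+ _]mulr_natr -mulrA divff ?mulr1//.
by rewrite pnatr_eq0 -lt0n.
Qed.

Lemma le_avg f g : (forall x, f x <= g x) -> avg f <= avg g.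
Proof. by move=> fg; rewrite ler_wpM2r ?invr_ge0 ?ler0n// ler_sum. Qed.

Lemma avg_ge0 f : (forall x, 0 <= f x) -> 0 <= avg f.
Proof. by move=> f0; rewrite -avg0; apply: le_avg. Qed.

Lemma avg_le a f : 0 <= a -> (forall x, f x <= a) -> avg f <= a.
Proof.
move=> a0 fa; case: (posnP #|T|) => [T0|T0]; last by rewrite -(avg_cst a T0) le_avg.
by rewrite /avg T0 invr0 mulr0.
Qed.

Lemma le_indicator (b c : bool) : (b -> c) -> b%:R <= c%:R :> R.
Proof. by case: b => // ->. Qed.

Lemma indicatorM (b c : bool) : (b && c)%:R = b%:R * c%:R :> R.
Proof. by case: b; rewrite ?mul1r ?mul0r. Qed.

Lemma density_ge0 P : 0 <= density P.
Proof. by apply: avg_ge0 => x; rewrite ler0n. Qed.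

Lemma density_le1 P : density P <= 1.
Proof. by apply: avg_le => // x; rewrite lern1 leq_b1. Qed.

Lemma eq_density P Q : P =1 Q -> density P = density Q.
Proof. by move=> PQ; apply: eq_avg => x; rewrite PQ. Qed.

Lemma density_card P : density P = #|P|%:R / #|T|%:R.
Proof.
rewrite /density /avg -natr_sum -sum1_card [in RHS]big_mkcond.
by congr (_%:R / _); apply: eq_bigr => x _; rewrite unfold_in; case: (P x).
Qed.

Lemma density_pred0 P : (forall x, ~~ P x) -> density P = 0.
Proof. by move=> P0; rewrite -avg0; apply: eq_avg => x; rewrite (negbTE (P0 x)). Qed.

Lemma density_pred1 a : density (pred1 a) = #|T|%:R^-1.
Proof. by rewrite density_card card1 div1r. Qed.

Lemma density_predT : (0 < #|T|)%N -> density xpredT = 1.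
Proof. exact: avg_cst. Qed.

Lemma le_density P Q : (forall x, P x -> Q x) -> density P <= density Q.
Proof. by move=> PQ; apply: le_avg => x; apply/le_indicator/PQ. Qed.

Lemma density_gt0 P : 0 < density P -> exists x, P x.
Proof.
move=> P_gt0; apply/existsP; apply: contraLR P_gt0 => /existsPn P0.
by rewrite density_pred0 ?ltxx.
Qed.

Lemma density_disjointU P Q :
  (forall x, P x -> ~~ Q x) -> density (fun x => P x || Q x) = density P + density Q.
Proof.
move=> PQ; rewrite -avgD; apply: eq_avg => x.
by move: (PQ x); case: (P x); case: (Q x) => //=; rewrite ?addr0 ?add0r // => /(_ isT).
Qed.

Lemma density_splitC P Q :
  density P = density (fun x => P x && Q x) + density (fun x => P x && ~~ Q x).
Proof.
rewrite -density_disjointU => [|x /andP[-> ->] //].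
by apply: eq_density => x; rewrite -andb_orr orbN andbT.
Qed.

Lemma density_le_bigU (I : finType) (A : pred I) (Q : I -> pred T) P :
  (forall x, P x -> exists2 i, A i & Q i x) ->
  density P <= \sum_(i | A i) density (Q i).
Proof.
move=> PQ; rewrite -[leRHS]mulr_suml exchange_big /=.
apply: le_avg => x; have nng i : A i -> 0 <= (Q i x)%:R :> R by rewrite ler0n.
case: (boolP (P x)) => [/PQ[i Ai Qix]|_]; last exact: sumr_ge0.
rewrite (bigD1 i)//= Qix lerDl; apply: sumr_ge0 => j /andP[Aj _]; exact: nng.
Qed.

Lemma density_leU P Q S :
  (forall x, P x -> Q x || S x) -> density P <= density Q + density S.
Proof.
move=> PQS; have := @density_le_bigU _ predT (fun b => if b then Q else S) P.
rewrite big_bool; apply.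
by move=> x /PQS/orP[Qx|Sx]; [exists true | exists false].
Qed.

Lemma density_leU3 P Q1 Q2 Q3 :
  (forall x, P x -> [|| Q1 x, Q2 x | Q3 x]) ->
  density P <= density Q1 + density Q2 + density Q3.
Proof.
move=> PQ; rewrite -addrA; apply: le_trans (density_leU PQ) _.
by rewrite lerD2l; apply: density_leU.
Qed.

Lemma density_markov f a : (forall x, 0 <= f x) -> 0 < a ->
  density (fun x => a < f x) <= avg f / a.
Proof.
move=> f0 a0; rewrite ler_pdivlMr// -avgZr; apply: le_avg => x.
by case: ltP => [/ltW|_]; rewrite ?mul1r ?mul0r.
Qed.

Lemma exists_gt_avg f c : c < avg f -> 0 <= c -> exists x, c < f x.
Proof.
move=> fc c0; apply/existsP; apply: contraLR fc => /existsPn f_le.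
by rewrite -leNgt avg_le// => x; rewrite leNgt f_le.
Qed.

Lemma exists_le_weighted_avg P f c :
  avg (fun x => (P x)%:R * f x) <= c -> 0 < density P ->
  exists2 x, P x & f x * density P <= c.
Proof.
move=> fc /density_gt0[x0 Px0]; have [x Px x_min] := arg_minP f Px0.
exists x => //; apply: le_trans fc; rewrite mulrC -avgZr.
by apply: le_avg => y; case Py: (P y); rewrite ?mul1r ?mul0r//; apply: x_min.
Qed.

Lemma density_above_half_avg f (c : R) : (forall x, f x <= 1) -> 0 <= c -> c <= avg f ->
  c / 2 <= density (fun x => c / 2 <= f x).
Proof.
move=> f1 c0 cf; have c2 : 0 <= c / 2 by rewrite divr_ge0.
have : avg f <= avg (fun x => (c / 2 <= f x)%R%:R + c / 2).
  apply: le_avg => x; case: (lerP (c / 2)) => [_|/ltW]; last by rewrite add0r.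
  by rewrite -[leLHS]addr0 lerD.
have : avg (fun=> c / 2) <= c / 2 by apply: avg_le.
by rewrite avgD -/(density _); lra.
Qed.

End Average.

Lemma avg_bij (R : realFieldType) (T U : finType) (g : T -> U) (f : U -> R) :
  bijective g -> avg (f \o g) = avg f.
Proof.
move=> gB; rewrite /avg (bij_eq_card gB); congr (_ / _).
by rewrite [RHS](reindex g) //; apply: onW_bij.
Qed.

Lemma avg_pair (R : realFieldType) (T U : finType) (f : T -> U -> R) :
  avg (fun p => f p.1 p.2) = avg (fun x => avg (f x)).
Proof.
rewrite /avg card_prod natrM invfM mulrA -pair_bigA.
by rewrite -mulr_suml mulrAC.
Qed.

Lemma avg_swap (R : realFieldType) (T U : finType) (f : T -> U -> R) :
  avg (fun x => avg (f x)) = avg (fun y => avg (f^~ y)).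
Proof. by rewrite /avg -!mulr_suml exchange_big mulrAC. Qed.

Section Density2.
Variables (R : realFieldType) (T U : finType).
Implicit Types (e : T -> U -> bool).

Definition density2 e : R := density R (fun p => e p.1 p.2).

Lemma density2E e : density2 e = avg (fun x => density R (e x)).
Proof. exact: (avg_pair (fun x y => (e x y)%:R)). Qed.

Lemma density2M (P : pred T) (Q : pred U) :
  density2 (fun x y => P x && Q y) = density R P * density R Q.
Proof.
rewrite density2E -avgZr; apply: eq_avg => x; rewrite -avgZl.
by apply: eq_avg => y; rewrite indicatorM.
Qed.

Lemma le_density2 e e' : (forall x y, e x y -> e' x y) -> density2 e <= density2 e'.
Proof. by move=> ee; apply: le_density => -[x y]; apply: ee. Qed.

Lemma density2_leU e e1 e2 : (forall x y, e x y -> e1 x y || e2 x y) ->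
  density2 e <= density2 e1 + density2 e2.
Proof. by move=> ee; apply: density_leU => -[x y]; apply: ee. Qed.

Lemma density2_leU3 e e1 e2 e3 : (forall x y, e x y -> [|| e1 x y, e2 x y | e3 x y]) ->
  density2 e <= density2 e1 + density2 e2 + density2 e3.
Proof. by move=> ee; apply: density_leU3 => -[x y]; apply: ee. Qed.

Lemma density2_ge0 e : 0 <= density2 e.
Proof. exact: density_ge0. Qed.

End Density2.

Lemma density2C (R : realFieldType) (T U : finType) (e : T -> U -> bool) :
  density2 R (fun y x => e x y) = density2 R e.
Proof. by rewrite !density2E avg_swap. Qed.

Lemma density2_fst (R : realFieldType) (T U : finType) (P : pred T) :
  (0 < #|U|)%N -> density2 R (fun x (_ : U) => P x) = density R P.
Proof. by move=> U0; rewrite density2E; apply: eq_avg => x; apply: avg_cst. Qed.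

Lemma density2_snd (R : realFieldType) (T U : finType) (P : pred U) :
  (0 < #|T|)%N -> density2 R (fun (_ : T) x => P x) = density R P.
Proof. by move=> T0; rewrite -density2C density2_fst. Qed.

Lemma density2_eq (R : realFieldType) (T : finType) :
  density2 R (fun x y : T => x == y) = #|T|%:R^-1.
Proof.
rewrite /density2 density_card card_prod (_ : #|_| = #|T|).
  have [->|T0] := posnP #|T|; first by rewrite mul0r invr0.
  by rewrite natrM invfM mulrA divff ?mul1r// pnatr_eq0 -lt0n.
rewrite -(card_imset T (f := fun x => (x, x))) => [|x y [] //].
apply: eq_card => -[x y]; apply/eqP/imsetP => [/= ->|[z _ [-> ->]]] //.
by exists y.
Qed.

Section Density3.
Variables (R : realFieldType) (V : finType).
Implicit Types (h : V -> V -> V -> bool).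

Definition density3 h : R := density R (fun t : V * V * V => h t.1.1 t.1.2 t.2).

Lemma le_density3 h h' :
  (forall x y z, h x y z -> h' x y z) -> density3 h <= density3 h'.
Proof. by move=> hh; apply: le_density => t; apply: hh. Qed.

Lemma density3_leU h h1 h2 : (forall x y z, h x y z -> h1 x y z || h2 x y z) ->
  density3 h <= density3 h1 + density3 h2.
Proof. by move=> hh; apply: density_leU => t; apply: hh. Qed.

Lemma density3_leU3 h h1 h2 h3 :
  (forall x y z, h x y z -> [|| h1 x y z, h2 x y z | h3 x y z]) ->
  density3 h <= density3 h1 + density3 h2 + density3 h3.
Proof. by move=> hh; apply: density_leU3 => t; apply: hh. Qed.

Lemma density3_ge0 h : 0 <= density3 h.
Proof. exact: density_ge0. Qed.

Lemma density3E h : density3 h = avg (fun x => density2 R (h x)).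
Proof.
rewrite /density3 /density (avg_pair (fun p z => (h p.1 p.2 z)%:R)).
rewrite (avg_pair (fun x y => avg (fun z => (h x y z)%:R))).
by apply: eq_avg => x; rewrite density2E.
Qed.

Lemma density3_pairE h : density3 h = avg (fun p => density R (h p.1 p.2)).
Proof. exact: (avg_pair (fun p z => (h p.1 p.2 z)%:R)). Qed.

Lemma density3_swap h : density3 (fun x y z => h y x z) = density3 h.
Proof.
apply: (@avg_bij _ _ _ (fun t => (t.1.2, t.1.1, t.2)) (fun t => (h t.1.1 t.1.2 t.2)%:R)).
by exists (fun t => (t.1.2, t.1.1, t.2)) => -[[]].
Qed.

Lemma density3_rot h : density3 (fun x y z => h y z x) = density3 h.
Proof.
apply: (@avg_bij _ _ _ (fun t => (t.1.2, t.2, t.1.1)) (fun t => (h t.1.1 t.1.2 t.2)%:R)).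
by exists (fun t => (t.2, t.1.1, t.1.2)) => -[[]].
Qed.

Lemma density3_rotr h : density3 (fun x y z => h z x y) = density3 h.
Proof. by rewrite -[RHS]density3_rot -[RHS]density3_rot. Qed.

Lemma density3_prodl (P : pred V) (e : V -> V -> bool) :
  density3 (fun x y z => P x && e y z) = density R P * density2 R e.
Proof.
rewrite density3E -avgZr; apply: eq_avg => x; rewrite -avgZl.
by apply: eq_avg => p; rewrite indicatorM.
Qed.

Lemma density3M (P Q S : pred V) :
  density3 (fun x y z => [&& P x, Q y & S z]) = density R P * density R Q * density R S.
Proof.
by rewrite (density3_prodl P (fun y z => Q y && S z)) density2M mulrA.
Qed.

Hypothesis V_gt0 : (0 < #|V|)%N.

Lemma density3_12 (e : V -> V -> bool) : density3 (fun x y _ => e x y) = density2 R e.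
Proof. exact: (density2_fst _ (fun p => e p.1 p.2)). Qed.

Lemma density3_23 (e : V -> V -> bool) : density3 (fun _ y z => e y z) = density2 R e.
Proof. by rewrite (density3_prodl predT) density_predT ?mul1r. Qed.

Lemma density3_13 (e : V -> V -> bool) : density3 (fun x _ z => e x z) = density2 R e.
Proof. by rewrite -density3_23 -[RHS]density3_swap. Qed.

End Density3.

(** * Arithmetic modulo 3 *)

Lemma Z3_ind (P : 'Z_3 -> Prop) : P 0 -> P 1 -> P (-1) -> forall i, P i.
Proof.
move=> P0 P1 P2 [[|[|[|//]]] hi].
- by rewrite (_ : Ordinal hi = 0)//; apply: val_inj.
- by rewrite (_ : Ordinal hi = 1)//; apply: val_inj.
- by rewrite (_ : Ordinal hi = -1)//; apply: val_inj.
Qed.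

Lemma Z3_succ_neq (i : 'Z_3) : i + 1 != i.
Proof. by elim/Z3_ind: i. Qed.

Lemma Z3_pred_neq (i : 'Z_3) : i - 1 != i.
Proof. by elim/Z3_ind: i. Qed.

Lemma Z3_succ_neq_pred (i : 'Z_3) : i + 1 != i - 1.
Proof. by elim/Z3_ind: i. Qed.

Lemma Z3_addr11 (i : 'Z_3) : i + 1 + 1 = i - 1.
Proof. by apply/eqP; elim/Z3_ind: i. Qed.

Lemma Z3_addr111 (i : 'Z_3) : i + 1 + 1 + 1 = i.
Proof. by rewrite Z3_addr11 addrK. Qed.

Lemma Z3_cases (i k : 'Z_3) : [\/ k = i, k = i + 1 | k = i - 1].
Proof.
have [->|ki] := eqVneq k i; first exact: Or31.
have [->|ki1] := eqVneq k (i + 1); first exact: Or32.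
by apply: Or33; apply/eqP; move: ki ki1; elim/Z3_ind: i; elim/Z3_ind: k.
Qed.

Lemma Z3_exists_third (i j : 'Z_3) : i != j -> exists2 k, k != i & k != j.
Proof. by exists (- (i + j)); move: i j H; elim/Z3_ind; elim/Z3_ind. Qed.

Lemma natr_Z3_eq0 k : (k%:R == 0 :> 'Z_3) = (3 %| k)%N.
Proof. by rewrite -val_eqE /= val_Zp_nat. Qed.

Lemma sum_Z3 (M : nmodType) (F : 'Z_3 -> M) i : \sum_j F j = F i + F (i + 1) + F (i - 1).
Proof.
rewrite (bigD1 i)//= (bigD1 (i + 1)) ?Z3_succ_neq//= (bigD1 (i - 1))/=; last first.
  by rewrite Z3_pred_neq eq_sym Z3_succ_neq_pred.
rewrite big1 ?addr0 ?addrA// => k /andP[/andP[ki ki1] ki2].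
by case: (Z3_cases i k) ki ki1 ki2 => ->; rewrite eqxx.
Qed.

(** * Ternary relations *)

Section TernaryRelation.
Variable V : Type.
Implicit Types h : V -> V -> V -> bool.

Definition symmetric3 h :=
  (forall x y z, h x y z = h y x z) /\ (forall x y z, h x y z = h y z x).

Definition irreflexive3 h := forall x z, h x x z = false.

Lemma symmetric3_swap h : symmetric3 h -> forall x y z, h x y z = h y x z.
Proof. by case. Qed.

Lemma symmetric3_rot h : symmetric3 h -> forall x y z, h x y z = h y z x.
Proof. by case. Qed.

Lemma symmetric3_rev h : symmetric3 h -> forall x y z, h x y z = h z y x.
Proof. by move=> [swap rot] x y z; rewrite rot swap. Qed.

Lemma symmetric3_swap23 h : symmetric3 h -> forall x y z, h x y z = h x z y.
Proof. by move=> [swap rot] x y z; rewrite swap rot. Qed.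

Lemma symmetric3_swaps h : (forall x y z, h x y z = h y x z) ->
  (forall x y z, h x y z = h x z y) -> symmetric3 h.
Proof. by move=> swap12 swap23; split=> // x y z; rewrite swap12 swap23. Qed.

Lemma symmetric3_perms h x y z : symmetric3 h -> h x y z ->
  [/\ h x z y, h y x z, h y z x, h z x y & h z y x].
Proof.
move=> hS hxyz; split; move: hxyz.
- by rewrite (symmetric3_swap23 hS).
- by rewrite (symmetric3_swap hS).
- by rewrite (symmetric3_rot hS).
- by rewrite !(symmetric3_rot hS x) (symmetric3_rot hS).
- by rewrite (symmetric3_rev hS).
Qed.

Lemma irreflexive3_sub h h' : (forall x y z, h' x y z -> h x y z) ->
  irreflexive3 h -> irreflexive3 h'.
Proof. by move=> sub hI x z; apply/negP => /sub; rewrite hI. Qed.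

End TernaryRelation.

Section Preimage.
Variables (U V : Type) (g : U -> V) (h : V -> V -> V -> bool).

Definition preim3 x y z := h (g x) (g y) (g z).

Lemma symmetric3_preim : symmetric3 h -> symmetric3 preim3.
Proof. by move=> [swap rot]; split=> x y z; [apply: swap | apply: rot]. Qed.

Lemma irreflexive3_preim : irreflexive3 h -> irreflexive3 preim3.
Proof. by move=> hI x z; apply: hI. Qed.

End Preimage.

Lemma irreflexive3_neq (V : eqType) (h : V -> V -> V -> bool) x y z :
  irreflexive3 h -> h x y z -> x != y.
Proof. by move=> hI; apply: contraTneq => ->; rewrite hI. Qed.

Lemma irreflexive3_neqs (V : eqType) (h : V -> V -> V -> bool) x y z :
  symmetric3 h -> irreflexive3 h -> h x y z -> [/\ x != y, y != z & x != z].
Proof.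
move=> hS hI hxyz; have [hxzy _ hyzx _ _] := symmetric3_perms hS hxyz.
by split; apply: irreflexive3_neq hI _; eassumption.
Qed.

(** * Tripartite colourings of pairs *)

Section PartialEquality.
Variable T : eqType.
Implicit Types a b c : option T.

Definition eq_some a b := (a == b) && (a != None).

Lemma eq_someC a b : eq_some a b = eq_some b a.
Proof. by rewrite /eq_some eq_sym; case: eqP => // ->. Qed.

Lemma eq_some_trans a b c : eq_some a b -> eq_some b c -> eq_some a c.
Proof. by move=> /andP[/eqP-> _]. Qed.

Lemma eq_SomeP a t : eq_some a (Some t) = (a == Some t).
Proof. by rewrite /eq_some; case: eqP => // ->. Qed.

End PartialEquality.

Section TripartiteColouring.
Variables (R : realFieldType) (V J : finType).
Variables (col : V -> V -> option J) (part : J -> V -> 'Z_3).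
Hypothesis colC : forall x y, col x y = col y x.
Hypothesis part_neq : forall j x y, col x y = Some j -> part j x != part j y.

Local Notation density := (density R).
Local Notation density2 := (density2 R).
Local Notation density3 := (density3 R).

Definition side_of v x := omap (fun j => (j, part j x)) (col v x).

Definition side j v i x := side_of v x == Some (j, i).

Definition corner v x y := eq_some (col v x) (col v y).

Definition same_side v x y := eq_some (side_of v x) (side_of v y).

Definition opposite v x y := corner v x y && ~~ same_side v x y.

Definition mono v x y := corner v x y && corner x v y.

Definition cornerless v x y := [&& ~~ corner v x y, ~~ corner x v y & ~~ corner y v x].

Definition unfilled v x y := opposite v x y && ~~ mono v x y.

Definition bad v x y :=
  [|| cornerless v x y, unfilled v x y, unfilled x v y | unfilled y v x].

Lemma sideE j v i x : side j v i x = (col v x == Some j) && (part j x == i).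
Proof.
rewrite /side /side_of; case: (col v x) => [k|] //=.
rewrite !(inj_eq (@Some_inj _)) xpair_eqE; by case: eqP => // ->.
Qed.

Lemma sideP j v i x : reflect (col v x = Some j /\ part j x = i) (side j v i x).
Proof. by rewrite sideE; apply: (iffP andP) => -[/eqP ? /eqP ?]. Qed.

Lemma cornerC v x y : corner v x y = corner v y x.
Proof. exact: eq_someC. Qed.

Lemma corner_third v x y : corner v x y -> corner x v y -> corner y v x.
Proof.
rewrite /corner (colC x v) (colC y v) (colC y x) => vxy.
by apply: eq_some_trans; rewrite eq_someC.
Qed.

Lemma same_sideC v x y : same_side v x y = same_side v y x.
Proof. exact: eq_someC. Qed.

Lemma same_side_trans v x y z : same_side v x y -> same_side v y z -> same_side v x z.
Proof. exact: eq_some_trans. Qed.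

Lemma same_side_corner v x y : same_side v x y -> corner v x y.
Proof.
rewrite /same_side /corner /side_of.
by case: (col v x) (col v y) => [j|] [k|] //= /andP[/eqP[-> _] _]; rewrite /eq_some eqxx.
Qed.

Lemma oppositeC v x y : opposite v x y = opposite v y x.
Proof. by rewrite /opposite cornerC same_sideC. Qed.

Lemma oppositeE j v x y : col v x = Some j -> col v y = Some j ->
  opposite v x y = (part j x != part j y).
Proof.
rewrite /opposite /corner /same_side /side_of => -> ->.
by rewrite /eq_some eqxx /= andbT (inj_eq (@Some_inj _)) xpair_eqE eqxx.
Qed.

Lemma mono_opposite v x y : mono v x y -> opposite v x y.
Proof.
case/andP => /andP[/eqP vxy]; case vx: (col v x) vxy => [j|] // /esym vy _.
rewrite /corner colC vx eq_someC eq_SomeP => /eqP/part_neq.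
by rewrite (oppositeE vx vy).
Qed.

Lemma symmetric3_mono : symmetric3 mono.
Proof.
apply: symmetric3_swaps => v x y; first by rewrite /mono andbC.
by apply/andP/andP => -[c1 c2]; split; rewrite 1?cornerC//; apply: corner_third;
  rewrite // cornerC.
Qed.

Lemma symmetric3_cornerless : symmetric3 cornerless.
Proof.
apply: symmetric3_swaps => v x y; rewrite /cornerless; first by rewrite andbCA (cornerC y).
by rewrite (cornerC v) (cornerC x v) (cornerC y v) [~~ corner x _ _ && _]andbC.
Qed.

Lemma unfilledC v x y : unfilled v x y = unfilled v y x.
Proof. by rewrite /unfilled oppositeC (symmetric3_swap23 symmetric3_mono). Qed.

Lemma symmetric3_bad : symmetric3 bad.
Proof.
apply: symmetric3_swaps => v x y; rewrite /bad.
  rewrite (symmetric3_swap symmetric3_cornerless) (unfilledC y); congr (_ || _).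
  exact: orbCA.
rewrite (symmetric3_swap23 symmetric3_cornerless) (unfilledC v x).
by rewrite [unfilled x _ _ || _]orbC.
Qed.

Lemma corner_count v x y :
  (corner v x y + corner x v y + corner y v x + cornerless v x y <= 1 + (mono v x y).*2)%N.
Proof.
have third1 := @corner_third v x y; have third2 := @corner_third v y x.
have third3 := @corner_third x y v.
rewrite (cornerC v y x) in third2; rewrite (cornerC x y v) (cornerC y x v) in third3.
rewrite /cornerless /mono; move: third1 third2 third3.
by case: corner; case: corner; case: corner => //= t1 t2 t3; auto.
Qed.

Lemma unfilled_bad v x y : unfilled v x y -> bad v x y.
Proof. by move=> u; rewrite /bad u !orbT. Qed.

Lemma bad_of_apex j v x y : col v x = Some j -> col v y = Some j ->
  part j x != part j y -> col x y != Some j -> bad v x y.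
Proof.
move=> vx vy pxy xy; apply: unfilled_bad; rewrite /unfilled (oppositeE vx vy) pxy /=.
by rewrite /mono negb_and orbC /corner (colC x v) vx eq_someC eq_SomeP xy.
Qed.

Lemma bad_of_base j v x y : col x y = Some j -> col v x != Some j -> col v y != Some j ->
  ~~ same_side v x y -> bad v x y.
Proof.
move=> xy vx vy nsame.
have ncx : ~~ corner x v y by rewrite /corner xy eq_SomeP colC.
have ncy : ~~ corner y v x by rewrite /corner (colC y x) xy eq_SomeP colC.
have [c|nc] := boolP (corner v x y); last by rewrite /bad /cornerless nc ncx ncy.
by apply: unfilled_bad; rewrite /unfilled /opposite c nsame /mono (negbTE ncx) andbF.
Qed.

Definition signed_side j v x : R :=
  (side j v (part j v + 1) x)%:R - (side j v (part j v - 1) x)%:R.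

Lemma signed_side_None j v x : col v x != Some j -> signed_side j v x = 0.
Proof. by rewrite /signed_side !sideE => /negbTE->; rewrite subrr. Qed.

Lemma signed_side_Some j v x : col v x = Some j ->
  signed_side j v x = if part j x == part j v + 1 then 1 else -1.
Proof.
move=> vx; rewrite /signed_side !sideE vx eqxx /=; have := part_neq vx.
have /negbTE ne : part j v - 1 != part j v + 1 by rewrite eq_sym Z3_succ_neq_pred.
case: (Z3_cases (part j v) (part j x)) => ->; rewrite ?eqxx//.
  by rewrite (negbTE (Z3_succ_neq_pred _)) subr0.
by rewrite ne sub0r.
Qed.

Lemma same_sub_opposite v x y :
  (same_side v x y)%:R - (opposite v x y)%:R = \sum_j signed_side j v x * signed_side j v y.
Proof.
case vx: (col v x) => [j|]; last first.
  rewrite big1 => [|j _]; last by rewrite signed_side_None ?mul0r ?vx.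
  by rewrite /opposite /same_side /corner /side_of vx /eq_some !andbF subrr.
rewrite (bigD1 j)//= big1 ?addr0 => [|k kj]; last first.
  by rewrite signed_side_None ?mul0r// vx (inj_eq (@Some_inj _)) eq_sym.
case: (eqVneq (col v y) (Some j)) => [vy|vy]; last first.
  have nc : ~~ corner v x y by rewrite /corner vx eq_someC eq_SomeP.
  have ns : ~~ same_side v x y by apply: contra nc; apply: same_side_corner.
  by rewrite (signed_side_None vy) mulr0 /opposite (negbTE nc) (negbTE ns) subrr.
rewrite !signed_side_Some// (oppositeE vx vy) /same_side /side_of vx vy /eq_some /= andbT.
rewrite (inj_eq (@Some_inj _)) xpair_eqE eqxx /=.
move: (part_neq vx) (part_neq vy).
elim/Z3_ind: (part j x); elim/Z3_ind: (part j y); elim/Z3_ind: (part j v) => //= _ _;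
  by rewrite ?mulr1 ?mulrNN ?mul1r ?subr0 ?sub0r.
Qed.

Definition side_gap j v : R :=
  density (side j v (part j v + 1)) - density (side j v (part j v - 1)).

Definition imbalance v : R := \sum_j side_gap j v ^+ 2.

Lemma avg_signed_side j v : avg (signed_side j v) = side_gap j v.
Proof. exact: avgB. Qed.

Lemma imbalanceE v : imbalance v = density2 (same_side v) - density2 (opposite v).
Proof.
rewrite -avgB (eq_avg (g := fun p => \sum_j signed_side j v p.1 * signed_side j v p.2)).
  rewrite avg_sum; apply: eq_bigr => j _.
  rewrite (avg_pair (fun x y => signed_side j v x * signed_side j v y)).
  by under eq_avg do rewrite avgZl; rewrite avgZr avg_signed_side.
by move=> p; apply: same_sub_opposite.
Qed.

Lemma imbalance_ge0 v : 0 <= imbalance v.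
Proof. by apply: sumr_ge0 => j _; apply: sqr_ge0. Qed.

Lemma side_gap_sqr_le j v : side_gap j v ^+ 2 <= imbalance v.
Proof.
by rewrite /imbalance (bigD1 j)//= lerDl; apply: sumr_ge0 => k _; apply: sqr_ge0.
Qed.

Lemma density2_corner v :
  density2 (corner v) = density2 (same_side v) + density2 (opposite v).
Proof.
apply: etrans (density_splitC _ _ (fun p => same_side v p.1 p.2)) _; congr (_ + _).
apply: eq_density => -[x y] /=; rewrite andbC; apply: andb_idr.
exact: same_side_corner.
Qed.

Lemma density3_opposite : density3 opposite = density3 mono + density3 unfilled.
Proof.
apply: etrans (density_splitC _ _ (fun t => mono t.1.1 t.1.2 t.2)) _; congr (_ + _).
by apply: eq_density => t; rewrite andbC; apply: andb_idr; apply: mono_opposite.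
Qed.

Lemma mono_count :
  4 * density3 mono + 6 * density3 unfilled + 3 * avg imbalance + density3 cornerless <= 1.
Proof.
have imb : avg imbalance = density3 same_side - density3 opposite.
  by rewrite !density3E -avgB; apply: eq_avg => v; rewrite imbalanceE.
have crn : density3 corner = density3 same_side + density3 opposite.
  by rewrite !density3E -avgD; apply: eq_avg => v; rewrite density2_corner.
have count : density3 corner + density3 (fun v x y => corner x v y)
    + density3 (fun v x y => corner y v x) + density3 cornerless - 2 * density3 mono <= 1.
  rewrite -avgZl -!avgD -avgB; apply: avg_le => // t.
  have := corner_count t.1.1 t.1.2 t.2; rewrite -(ler_nat R) !natrD -muln2 natrM; lra.
rewrite (density3_swap R corner) (density3_rotr R corner) in count; have := density3_opposite; lra.
Qed.

Lemma density3_bad_le : density3 bad <= density3 cornerless + 3 * density3 unfilled.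
Proof.
have badU := density3_leU R (fun v x y => id : bad v x y -> _).
have := density3_leU3 R
  (fun v x y => id : [|| unfilled v x y, unfilled x v y | unfilled y v x] -> _).
rewrite (density3_swap R unfilled) (density3_rotr R unfilled); lra.
Qed.

Variable rho : R.
Hypotheses (rho_gt0 : 0 < rho) (rho_small : rho <= (1 / 50) ^+ 2).
Hypothesis many_mono : 1 / 4 - rho ^+ 4 / 4 <= density3 mono.
Local Notation eps := (rho ^+ 2).

Let eps_gt0 : 0 < eps. Proof. by rewrite exprn_gt0. Qed.

Let eps_small : eps <= rho / 100.
Proof. by rewrite expr2 ler_pM2l//; have := rho_small; lra. Qed.

Let rho4_small : rho ^+ 4 <= eps / 100.
Proof.
rewrite (_ : rho ^+ 4 = eps * eps); last by rewrite -exprD.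
by rewrite ler_pM2l//; have := eps_small; have := rho_small; lra.
Qed.

Definition typical v := (density2 (bad v) <= eps) && (imbalance v <= eps).

Lemma bad_imbalance_small : density3 bad + avg imbalance <= rho ^+ 4.
Proof.
have imb0 : 0 <= avg imbalance by apply: avg_ge0; apply: imbalance_ge0.
have unf0 := density3_ge0 R unfilled.
have := mono_count; have := density3_bad_le; have := many_mono; lra.
Qed.

Lemma density3_bad_small : density3 bad <= eps.
Proof.
apply: (@le_trans _ _ (rho ^+ 4)); last by have := rho4_small; have := eps_gt0; lra.
apply: le_trans bad_imbalance_small; rewrite lerDl.
by apply: avg_ge0; apply: imbalance_ge0.
Qed.

Lemma density_atypical : density (fun v => ~~ typical v) <= eps.
Proof.
pose defect v := density2 (bad v) + imbalance v.
have defect0 v : 0 <= defect v by rewrite addr_ge0 ?density_ge0 ?imbalance_ge0.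
apply: (@le_trans _ _ (density (fun v => eps < defect v))).
  apply: le_density => v; rewrite negb_and -!ltNge /defect.
  have := density2_ge0 R (bad v); have := imbalance_ge0 v.
  by move=> imb0 bad0 /orP[] ?; lra.
apply: le_trans (density_markov defect0 eps_gt0) _.
by rewrite ler_pdivrMr// -exprD avgD -density3E bad_imbalance_small.
Qed.

Lemma typical_bad v : typical v -> density2 (bad v) <= eps.
Proof. by case/andP. Qed.

Lemma typical_side_gap j v : typical v -> `|side_gap j v| <= rho.
Proof.
move=> /andP[_ imb]; rewrite -ler_sqr ?nnegrE// ?(ltW rho_gt0)// real_normK ?num_real//.
exact: le_trans (side_gap_sqr_le j v) imb.
Qed.

Lemma density_sides j v :
  density (side j v (part j v + 1)) + density (side j v (part j v - 1)) =
  density (fun x => col v x == Some j).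
Proof.
rewrite -density_disjointU => [|x]; last first.
  by rewrite !sideE => /andP[-> /eqP->] /=; apply: Z3_succ_neq_pred.
apply: eq_density => x; rewrite !sideE -andb_orr; apply: andb_idr => /eqP/part_neq.
by case: (Z3_cases (part j v) (part j x)) => ->; rewrite eqxx ?orbT.
Qed.

Lemma density_side_le j v i : typical v -> density (side j v i) <= (1 + rho) / 2.
Proof.
move=> /(typical_side_gap j); rewrite ler_norml => /andP[].
rewrite /side_gap; have := density_sides j v; have := density_le1 R (fun x => col v x == Some j).
case: (Z3_cases (part j v) i) => ->; try lra.
rewrite [X in _ -> _ -> _ -> _ -> X <= _]density_pred0 => [|x]; first by lra.
by rewrite sideE; apply/negP => /andP[/eqP/part_neq]; rewrite eq_sym => /negbTE->.
Qed.

Lemma density_same_side_le v y : typical v -> density (same_side v y) <= (1 + rho) / 2.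
Proof.
move=> typ_v; case vy: (side_of v y) => [[j i]|].
  apply: le_trans (density_side_le j i typ_v); apply: le_density => x.
  by rewrite /same_side vy eq_someC eq_SomeP.
rewrite density_pred0 => [|x]; first by have := rho_gt0; lra.
by rewrite /same_side vy /eq_some andbF.
Qed.

Lemma exists_typical_gt (f : V -> R) c : (forall v, f v <= 1) -> 0 <= c ->
  c + eps < avg f -> exists2 v, typical v & c < f v.
Proof.
move=> f1 c0 cf.
have [v] : exists v, c < (typical v)%:R * f v.
  apply: exists_gt_avg => //.
  have : avg f - density (fun v => ~~ typical v) <= avg (fun v => (typical v)%:R * f v).
    rewrite -avgB; apply: le_avg => v; case: (typical v); rewrite /= ?mul1r ?mul0r ?subr0//.
    by rewrite subr_le0.
  by have := density_atypical; lra.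
case: (boolP (typical v)) => [typ_v|_]; rewrite ?mul1r ?mul0r => cfv; last by lra.
by exists v.
Qed.

Definition nonadjacent j (X Y : pred V) : R :=
  density2 (fun x y => [&& X x, Y y & col x y != Some j]).

Lemma nonadjacentC j X Y : nonadjacent j X Y = nonadjacent j Y X.
Proof.
rewrite /nonadjacent -density2C; apply: eq_density => -[x y] /=.
by rewrite colC andbCA.
Qed.

Lemma nonadjacent_sides j v i k : i != k ->
  nonadjacent j (side j v i) (side j v k) <= density2 (bad v).
Proof.
move=> ik; apply: le_density2 => x y /and3P[/sideP[vx xi] /sideP[vy yk]].
by apply: bad_of_apex; rewrite // xi yk.
Qed.

Lemma nonadjacent_side_r j x (X : pred V) i k : (forall y, X y -> part j y = i) -> i != k ->
  nonadjacent j X (side j x k) <= density (fun y => X y && (col x y != Some j)) + density2 (bad x).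
Proof.
move=> Xi ik; have V_gt0 : (0 < #|V|)%N by apply/card_gt0P; exists x.
rewrite -(density2_fst _ _ V_gt0); apply: density2_leU => y z /and3P[Xy /sideP[xz zk] yz].
rewrite Xy /=; case: eqP => //= xy.
by apply: (bad_of_apex xy xz) => //; rewrite (Xi _ Xy) zk.
Qed.

Lemma nonadjacent_trans j (X Y Z : pred V) i k : (forall x, X x -> part j x = i) ->
  (forall z, Z z -> part j z = k) -> i != k ->
  density Y * nonadjacent j X Z <= nonadjacent j X Y + nonadjacent j Y Z + density3 bad.
Proof.
move=> Xi Zk ik; have [V0|V_gt0] := posnP #|V|.
  rewrite [density Y]density_card V0 invr0 mulr0 mul0r.
  by rewrite !addr_ge0// density_ge0.
rewrite [nonadjacent j X Y]nonadjacentC /nonadjacent -density3_prodl.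
rewrite -(density3_12 R V_gt0 (fun y x => [&& Y y, X x & col y x != Some j])).
rewrite -(density3_13 R V_gt0 (fun y z => [&& Y y, Z z & col y z != Some j])).
apply: density3_leU3 => y x z /and4P[Yy Xx Zz xz]; rewrite Yy Xx Zz /=.
case: eqP => //= yx; case: eqP => //= yz.
by apply: (bad_of_apex yx yz); rewrite ?(Xi _ Xx) ?(Zk _ Zz).
Qed.

Lemma exists_major_colour : exists v j,
  [/\ typical v, 1 / 4 - rho <= density (side j v (part j v + 1)) &
      1 / 4 - rho <= density (side j v (part j v - 1))].
Proof.
have [v typ_v opp_v] : exists2 v, typical v & 1 / 4 - 3 * eps < density2 (opposite v).
  apply: exists_typical_gt => [v||]; first exact: density_le1.
    by have := eps_small; have := rho_small; lra.
  rewrite -density3E density3_opposite.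
  have := density3_ge0 R unfilled; have := many_mono; have := rho4_small.
  by have := eps_gt0; lra.
have [x] : exists x, 1 / 2 - 6 * eps < density (corner v x).
  apply: exists_gt_avg; last by have := eps_small; have := rho_small; lra.
  by rewrite -density2E density2_corner; have := imbalanceE v; have := imbalance_ge0 v; lra.
case vx: (col v x) => [j|] major; last first.
  move: major; rewrite density_pred0 => [|y]; last by rewrite /corner vx /eq_some andbF.
  by have := eps_small; have := rho_small; lra.
have {}major : 1 / 2 - 6 * eps < density (fun y => col v y == Some j).
  apply: lt_le_trans major _; apply: le_density => y.
  by rewrite /corner vx eq_someC eq_SomeP.
exists v, j; rewrite -density_sides in major.
have := typical_side_gap j typ_v; rewrite /side_gap ler_norml => /andP[].
by have := eps_small; split=> //; lra.
Qed.

Lemma exists_typical_almost_complete j (X Y : pred V) : 1 / 5 + eps <= density X ->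
  exists x, [/\ X x, typical x &
    density (fun y => Y y && (col x y != Some j)) <= 5 * nonadjacent j X Y].
Proof.
move=> X_big; have Xtyp : 1 / 5 <= density (fun x => X x && typical x).
  have : density X <= density (fun x => X x && typical x) + density (fun x => ~~ typical x).
    by apply: density_leU => x ->; rewrite /= orbN.
  by have := density_atypical; lra.
have [||x /andP[Xx typ_x] le_x] := @exists_le_weighted_avg _ _ (fun x => X x && typical x)
  (fun x => density (fun y => Y y && (col x y != Some j))) (nonadjacent j X Y).
- rewrite /nonadjacent density2E; apply: le_avg => x; rewrite -avgZl; apply: le_avg => y.
  by rewrite -indicatorM; apply: le_indicator => /andP[/andP[->]].
- by apply: lt_le_trans Xtyp; rewrite divr_gt0.
exists x; split=> //; have := density_ge0 R (fun y => Y y && (col x y != Some j)).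
by move: le_x Xtyp; nra.
Qed.

Definition is_core j (C : 'Z_3 -> pred V) :=
  [/\ forall i x, C i x -> part j x = i,
      forall i, 1 / 4 - 3 * rho <= density (C i) &
      forall i k, i != k -> nonadjacent j (C i) (C k) <= rho].

(* The two sides of a typical vertex [v] in its main colour provide two parts of the core; the
   third one is a side of a typical vertex [x] of the first part, on the part of [v]. *)
Lemma exists_core : exists j C, is_core j C.
Proof.
have [v [j [typ_v P_big Q_big]]] := exists_major_colour.
set t := part j v in P_big Q_big; pose P := side j v (t + 1); pose Q := side j v (t - 1).
have Pt x : P x -> part j x = t + 1 by case/sideP.
have Qt x : Q x -> part j x = t - 1 by case/sideP.
have PQ : nonadjacent j P Q <= eps.
  by apply: le_trans (nonadjacent_sides _ _ (Z3_succ_neq_pred _)) (typical_bad typ_v).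
have [|x [Px typ_x QNx]] := @exists_typical_almost_complete j P Q.
  by have := eps_small; have := rho_small; move: P_big; rewrite -/P; lra.
pose S := side j x t; have St z : S z -> part j z = t by case/sideP.
have xt : part j x = t + 1 by apply: Pt.
have S_big : 1 / 4 - 3 * rho <= density S.
  have := typical_side_gap j typ_x; rewrite /side_gap xt Z3_addr11 addrK -/S.
  have : density Q <= density (side j x (t - 1)) + density (fun y => Q y && (col x y != Some j)).
    by apply: density_leU => y Qy; rewrite sideE Qy (Qt _ Qy) eqxx andbT orbN.
  rewrite ler_norml => hQ /andP[]; have := eps_small; have := rho_gt0.
  by move: Q_big; rewrite -/Q; lra.
have QS : nonadjacent j Q S <= 6 * eps.
  apply: le_trans (nonadjacent_side_r x Qt (Z3_pred_neq t)) _.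
  by have := typical_bad typ_x; lra.
have PS : nonadjacent j P S <= rho.
  have := nonadjacent_trans Q Pt St (Z3_succ_neq t).
  have := density3_bad_small; have := density2_ge0 R (fun x y => [&& P x, S y & col x y != Some j]).
  have := eps_small; have := rho_small; have := rho_gt0.
  by move: Q_big; rewrite -/Q -/(nonadjacent j P S); nra.
have nt1 := negbTE (Z3_succ_neq t); have nt2 := negbTE (Z3_pred_neq t).
have n12 : (t - 1 == t + 1) = false by rewrite eq_sym (negbTE (Z3_succ_neq_pred t)).
exists j, (fun i => if i == t then S else if i == t + 1 then P else Q); split.
- by move=> i; case: (Z3_cases t i) => ->; rewrite ?nt1 ?nt2 ?n12 ?eqxx.
- by move=> i; case: ifP => _ //; case: ifP => _; have := rho_gt0; lra.
have [PQr QSr] : nonadjacent j P Q <= rho /\ nonadjacent j Q S <= rho.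
  by have := eps_small; have := rho_gt0; split; lra.
move=> i k; case: (Z3_cases t i) => ->; case: (Z3_cases t k) => ->;
  by rewrite ?nt1 ?nt2 ?n12 ?eqxx// nonadjacentC.
Qed.

Section Core.
Variables (j : J) (C : 'Z_3 -> pred V).
Hypothesis coreC : is_core j C.

Definition seen v i x := C i x && (col v x == Some j).

Definition missed v i x := C i x && (col v x != Some j).

Let C_part i x : C i x -> part j x = i. Proof. by have [+ _ _] := coreC; apply. Qed.

Lemma density_seen_missed v i : 1 / 4 - 3 * rho <= density (seen v i) + density (missed v i).
Proof.
have [_ /(_ i) C_big _] := coreC.
by rewrite (density_splitC _ _ (fun x => col v x == Some j)) in C_big.
Qed.

Lemma density_seenM_missed v i k : typical v -> i != k -> k != part j v ->
  density (seen v i) * density (missed v k) <= 2 * rho.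
Proof.
move=> typ_v ik kv; rewrite -density2M.
have : density2 (fun x y => seen v i x && missed v k y) <=
    nonadjacent j (C i) (C k) + density2 (bad v).
  apply: density2_leU => x y /andP[/andP[Ci /eqP vx] /andP[Ck vy]]; rewrite Ci Ck /=.
  case: eqP => //= xy; rewrite (symmetric3_swap symmetric3_bad).
  by apply: (@bad_of_apex j); rewrite // 1?colC// (C_part Ck) eq_sym.
have [_ _ /(_ i k ik)] := coreC; have := typical_bad typ_v.
by have := eps_small; have := rho_gt0; lra.
Qed.

Lemma density2_missed_apart v i k : typical v -> i != k ->
  density2 (fun x y => [&& missed v i x, missed v k y & ~~ same_side v x y]) <= 2 * rho.
Proof.
move=> typ_v ik.
have : density2 (fun x y => [&& missed v i x, missed v k y & ~~ same_side v x y]) <=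
    nonadjacent j (C i) (C k) + density2 (bad v).
  apply: density2_leU => x y /and3P[/andP[Ci vx] /andP[Ck vy] apart]; rewrite Ci Ck /=.
  by case: eqP => //= xy; apply: (@bad_of_base j).
have [_ _ /(_ i k ik)] := coreC; have := typical_bad typ_v.
by have := eps_small; have := rho_gt0; lra.
Qed.

Lemma exists_near_side v i k l : typical v -> i != k -> i != l -> 1 / 5 <= density (missed v i) ->
  exists y, density (fun x => (missed v k x || missed v l x) && ~~ same_side v y x) <= 20 * rho.
Proof.
move=> typ_v ik il i_big; pose M x := missed v k x || missed v l x.
pose far y := density (fun x => M x && ~~ same_side v y x).
have [||y _ far_y] := @exists_le_weighted_avg R V (missed v i) far (4 * rho).
- have := density2_missed_apart typ_v ik; have := density2_missed_apart typ_v il.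
  have : density2 (fun y x => [&& missed v i y, M x & ~~ same_side v y x]) <=
    density2 (fun y x => [&& missed v i y, missed v k x & ~~ same_side v y x]) +
    density2 (fun y x => [&& missed v i y, missed v l x & ~~ same_side v y x]).
    by apply: density2_leU => y x /and3P[-> + ->]; rewrite /= !andbT.
  rewrite density2E (eq_avg (g := fun y => (missed v i y)%:R * far y)) => [|y]; first by lra.
  by rewrite -avgZl; apply: eq_avg => x; rewrite indicatorM.
- by apply: lt_le_trans i_big; lra.
exists y; rewrite -/(far y); have : 0 <= far y by apply: density_ge0.
by move: far_y i_big; nra.
Qed.

Lemma density_missed_off_side_le v y i k : typical v -> i != k ->
  1 / 10 <= density (fun x => missed v k x && same_side v y x) ->
  density (fun x => missed v i x && ~~ same_side v y x) <= 20 * rho.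
Proof.
move=> typ_v ik k_big; have := density2_missed_apart typ_v ik.
have : density (fun x => missed v i x && ~~ same_side v y x) *
    density (fun x => missed v k x && same_side v y x) <=
  density2 (fun x z => [&& missed v i x, missed v k z & ~~ same_side v x z]).
  rewrite -density2M; apply: le_density2 => x z /andP[/andP[-> yx] /andP[-> yz]] /=.
  by apply: contraNN yx => xz; rewrite (same_side_trans yz)// same_sideC.
by have := density_ge0 R (fun x => missed v i x && ~~ same_side v y x); move: k_big; nra.
Qed.

(* Otherwise [v] would have almost the whole core on a single one of its sides. *)
Lemma exists_seen v : typical v -> exists i, 1 / 25 < density (seen v i).
Proof.
move=> typ_v; apply/existsP; apply: contraT => /existsPn unseen.
have big i : 1 / 5 <= density (missed v i).
  have := density_seen_missed v i; have := unseen i; rewrite -leNgt.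
  by have := rho_small; lra.
have disj i k x : i != k -> missed v i x -> ~~ missed v k x.
  by move=> ik /andP[/C_part xi _]; apply: contraNN ik => /andP[/C_part <- _]; rewrite xi.
pose M x := missed v 1 x || missed v (-1) x.
have [//|//|y off_M] := @exists_near_side v 0 1 (-1) typ_v _ _ (big 0).
rewrite -/M in off_M.
have on_side1 : 1 / 10 <= density (fun x => missed v 1 x && same_side v y x).
  have : density (missed v 1) <= density (fun x => missed v 1 x && same_side v y x) +
      density (fun x => M x && ~~ same_side v y x).
    by apply: density_leU => x; rewrite /M => ->; rewrite /= orbN.
  by have := big 1; have := rho_small; lra.
have off_side0 := density_missed_off_side_le typ_v (isT : 0 != 1 :> 'Z_3) on_side1.
have : density (fun x => missed v 0 x || M x) <= density (same_side v y) +
    density (fun x => M x && ~~ same_side v y x) +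
    density (fun x => missed v 0 x && ~~ same_side v y x).
  by apply: density_leU3 => x; case: same_side; rewrite //= !andbT orbC.
rewrite density_disjointU => [|x M0x]; last by rewrite negb_or !(disj 0).
rewrite density_disjointU => [|x]; last exact: disj.
have := density_same_side_le y typ_v; have := rho_small.
by have := big 0; have := big 1; have := big (-1); lra.
Qed.

Lemma typical_sees_core v i : typical v -> i != part j v -> density (missed v i) <= 1 / 25.
Proof.
move=> typ_v iv; have [k k_seen] := exists_seen typ_v.
have kv : k != part j v.
  apply: contraTneq k_seen => ->; rewrite -leNgt density_pred0 ?divr_ge0// => x.
  by apply/negP => /andP[/C_part xv /eqP/part_neq]; rewrite xv eqxx.
have missed_small l : l != k -> l != part j v -> density (missed v l) <= 50 * rho.
  move=> lk lv; have := density_seenM_missed typ_v (_ : k != l) lv; rewrite eq_sym lk.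
  by move=> /(_ isT); have := density_ge0 R (missed v l); move: k_seen; nra.
have [->|ik] := eqVneq i k; last first.
  by have := missed_small _ ik iv; have := rho_small; lra.
have [l lk lv] := Z3_exists_third kv.
have l_seen : 1 / 25 <= density (seen v l).
  by have := missed_small _ lk lv; have := density_seen_missed v l; have := rho_small; lra.
have := density_seenM_missed typ_v lk kv; have := density_ge0 R (missed v k).
by move: l_seen; have := rho_small; nra.
Qed.

Definition class i x := typical x && (part j x == i).

Lemma density_class_nonadjacent i k x : i != k -> class i x ->
  density (fun y => class k y && (col x y != Some j)) <= 6 * eps.
Proof.
move=> ik /andP[typ_x /eqP xi]; have [l li lk] := Z3_exists_third ik.
have [_ C_big _] := coreC.
suff : density (fun y => class k y && (col x y != Some j)) / 6 <= density2 (bad x).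
  by have := typical_bad typ_x; lra.
rewrite density2E -avgZr; apply: le_avg => y.
case: (boolP (class k y && _)) => [/andP[/andP[typ_y /eqP yk] xy]|_]; last first.
  by rewrite mul0r density_ge0.
rewrite mul1r.
have : density (C l) <= density (bad x y) + density (missed x l) + density (missed y l).
  apply: density_leU3 => z Cz; rewrite /missed Cz /=.
  case: eqP => [xz|]; rewrite ?orbT//; case: eqP => [yz|]; rewrite ?orbT// orbF.
  rewrite (symmetric3_rot symmetric3_bad) (symmetric3_rot symmetric3_bad).
  by apply: (@bad_of_apex j); rewrite // 1?colC// xi yk.
have := typical_sees_core typ_x (_ : l != part j x); rewrite xi => /(_ li).
have := typical_sees_core typ_y (_ : l != part j y); rewrite yk => /(_ lk).
by have := C_big l; have := rho_small; lra.
Qed.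

Lemma density_class_sum : density (class 0) + density (class 1) + density (class (-1)) =
  density typical.
Proof.
rewrite -!density_disjointU; first by apply: eq_density => x; rewrite /class -!andb_orr;
  apply: andb_idr => _; elim/Z3_ind: (part j x).
all: by move=> x; rewrite /class; case: typical; elim/Z3_ind: (part j x).
Qed.

Lemma density_class_close i :
  `|density (class (i + 1)) - density (class (i - 1))| <= 2 * rho.
Proof.
have [x /[dup] Kx /andP[typ_x /eqP xi]] : exists x, class i x.
  apply: (@density_gt0 R).
  have : density (C i) <= density (class i) + density (fun x => ~~ typical x).
    by apply: density_leU => x /C_part; rewrite /class => ->; rewrite eqxx andbT orbN.
  have [_ /(_ i) C_big _] := coreC; have := density_atypical.
  by have := eps_small; have := rho_small; lra.
have le_side k : i != k -> density (class k) <= density (side j x k) + 6 * eps.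
  move=> ik; apply: le_trans (lerD (lexx _) (density_class_nonadjacent ik Kx)).
  by apply: density_leU => y Ky; have /andP[_ yk] := Ky; rewrite sideE yk Ky andbT orbN.
have side_le k : density (side j x k) <= density (class k) + eps.
  apply: le_trans (lerD (lexx _) density_atypical).
  by apply: density_leU => y /sideP[_ yk]; rewrite /class yk eqxx andbT orbN.
have := typical_side_gap j typ_x; rewrite /side_gap xi !ler_norml => /andP[].
have := le_side (i + 1); rewrite eq_sym Z3_succ_neq => /(_ isT).
have := le_side (i - 1); rewrite eq_sym Z3_pred_neq => /(_ isT).
have := side_le (i + 1); have := side_le (i - 1); have := eps_small; have := rho_gt0.
by move=> *; apply/andP; split; lra.
Qed.

Lemma density_class i : `|density (class i) - 1 / 3| <= 2 * rho.
Proof.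
have V_gt0 : (0 < #|V|)%N.
  have [x _] : exists x, C 0 x; last by apply/card_gt0P; exists x.
  apply: (@density_gt0 R); have [_ /(_ 0) C_big _] := coreC.
  by have := rho_small; lra.
have typ_lo : 1 - eps <= density typical.
  rewrite -(density_predT R V_gt0) (density_splitC _ _ typical) /=.
  by have := density_atypical; lra.
have := density_class_close 0; have := density_class_close 1; have := density_class_close (-1).
have := density_class_sum; have := density_le1 R typical; have := eps_small; have := rho_gt0.
rewrite !ler_norml add0r sub0r addNr [1 - 1]subrr.
rewrite (_ : 1 + 1 = -1 :> 'Z_3); last by apply/eqP.
rewrite (_ : -1 - 1 = 1 :> 'Z_3); last by apply/eqP.
move=> r0 e0 le1 sum /andP[a1 a2] /andP[b1 b2] /andP[c1 c2].
by apply/andP; elim/Z3_ind: i; split; lra.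
Qed.

End Core.

Theorem mono_triangle_stability : exists j (G : 'Z_3 -> pred V),
  [/\ forall i x, G i x -> part j x = i,
      density (fun x => ~~ G (part j x) x) <= rho,
      forall i, `|density (G i) - 1 / 3| <= 2 * rho &
      forall i k x, i != k -> G i x ->
        density (fun y => G k y && (col x y != Some j)) <= rho].
Proof.
have [j [C coreC]] := exists_core; exists j, (class j).
have eps_rho : 6 * eps <= rho by have := eps_small; have := rho_gt0; lra.
split.
- by move=> i x /andP[_ /eqP].
- apply: le_trans (_ : density (fun x => ~~ typical x) <= _).
    by apply: le_density => x; rewrite /class eqxx andbT.
  by apply: le_trans density_atypical _; have := eps_gt0; lra.
- exact: density_class coreC.
by move=> i k x ik Gx; apply: le_trans (density_class_nonadjacent coreC ik Gx) eps_rho.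
Qed.

End TripartiteColouring.

(** * Tight walks *)

Section Walk.
Variable V : finType.
Implicit Types h : V -> V -> V -> bool.

(* [walk h k x y a b]: a tight walk with [k] edges whose first two vertices are [x, y] and whose
   last two are [a, b]. *)
Inductive walk h : nat -> V -> V -> V -> V -> Prop :=
| walk0 x y : walk h 0 x y x y
| walkS k x y z a b : h x y z -> walk h k y z a b -> walk h k.+1 x y a b.

(* As in [C_l^-], one edge is missing: [z, x, y] need not be an edge. *)
Definition closed_walk h l := exists x y z, walk h l.-1 x y z x.

Lemma walk1 h x y z : h x y z -> walk h 1 x y y z.
Proof. by move=> hx; apply: walkS hx (walk0 _ _ _). Qed.

Lemma walk0E h x y a b : walk h 0 x y a b -> a = x /\ b = y.
Proof. by move=> w; inversion w. Qed.

Lemma walkSE h k x y a b : walk h k.+1 x y a b -> exists2 z, h x y z & walk h k y z a b.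
Proof. by move=> w; inversion w; subst; exists z. Qed.

Lemma walk_cat h i j x y a b c d :
  walk h i x y a b -> walk h j a b c d -> walk h (i + j) x y c d.
Proof. by move=> w; elim: w c d => // k u v z a' b' e _ IH c d /IH; apply: walkS. Qed.

Lemma walk_rcons h k x y a b c : walk h k x y a b -> h a b c -> walk h k.+1 x y b c.
Proof. by move=> w /walk1 w1; rewrite -addn1; apply: walk_cat w w1. Qed.

Lemma walk_split h i j x y a b : walk h (i + j) x y a b ->
  exists c d, walk h i x y c d /\ walk h j c d a b.
Proof.
elim: i x y => [|i IH] x y; first by move=> w; exists x, y; split=> //; apply: walk0.
rewrite addSn => /walkSE[z hz /IH[c [d [w1 w2]]]].
by exists c, d; split=> //; apply: walkS w1.
Qed.

Lemma walk_last h k x y a b : walk h k.+1 x y a b -> exists2 w, walk h k x y w a & h w a b.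
Proof.
rewrite -addn1 => /walk_split[c [d [w1 /walkSE[z hz /walk0E[-> ->]]]]].
by exists c.
Qed.

Lemma walk_fun h k x y a b : walk h k x y a b ->
  exists g : nat -> V, [/\ g 0%N = x, g 1%N = y, g k = a, g k.+1 = b &
    forall i, (i < k)%N -> h (g i) (g i.+1) (g i.+2)].
Proof.
elim=> [u v|{}k u v z c d huvz _ [g [g0 g1 gk gk1 gh]]].
  by exists (fun i => if i is 0 then u else v).
exists (fun i => if i is i'.+1 then g i' else u); split=> //.
by case=> [_|i ik]; [rewrite g0 g1 | apply: gh].
Qed.

End Walk.

Lemma walk_map (U V : finType) (g : U -> V) (h : U -> U -> U -> bool) (h' : V -> V -> V -> bool)
    k x y a b :
  (forall x y z, h x y z -> h' (g x) (g y) (g z)) ->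
  walk h k x y a b -> walk h' k (g x) (g y) (g a) (g b).
Proof. by move=> hh; elim=> [*|{}k u v z c d /hh + _]; [apply: walk0 | apply: walkS]. Qed.

Lemma walk_sub (V : finType) (h h' : V -> V -> V -> bool) k x y a b :
  (forall x y z, h x y z -> h' x y z) -> walk h k x y a b -> walk h' k x y a b.
Proof. exact: (walk_map (g := id)). Qed.

Definition locally_tripartite (V : finType) (h : V -> V -> V -> bool) K :=
  forall k x y z, (k <= K)%N -> x != y -> walk h k x y z x -> (3 %| k.+1)%N.

Lemma locally_tripartite_sub (V : finType) (h h' : V -> V -> V -> bool) K :
  (forall x y z, h' x y z -> h x y z) -> locally_tripartite h K -> locally_tripartite h' K.
Proof. by move=> sub hK k x y z kK xy /(walk_sub sub); apply: hK. Qed.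

Lemma locally_tripartite_preim (U V : finType) (g : U -> V) (h : V -> V -> V -> bool) K :
  injective g -> locally_tripartite h K -> locally_tripartite (preim3 g h) K.
Proof.
move=> g_inj hK k x y z kK xy w; apply: (hK k (g x) (g y) (g z) kK).
  by rewrite (inj_eq g_inj).
exact: walk_map w.
Qed.

Section SymmetricWalk.
Variables (V : finType) (h : V -> V -> V -> bool).
Hypothesis hS : symmetric3 h.

Lemma walk_rev k x y a b : walk h k x y a b -> walk h k b a y x.
Proof.
elim=> [u v|{}k u v z c d huvz _ IH]; first exact: walk0.
by apply: walk_rcons IH _; rewrite -(symmetric3_rev hS).
Qed.

Lemma walk_back k x y a b : walk h k x y a b -> walk h (2 * k) a b x y.
Proof.
elim=> [u v|{}k u v z c d huvz _ IH]; first exact: walk0.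
have [_ _ hvzu hzuv _] := symmetric3_perms hS huvz.
by rewrite mulnS addnC addn2; apply: walk_rcons (walk_rcons IH hvzu) hzuv.
Qed.

Lemma walk_spin k x y a b t : walk h k.+1 x y a b -> walk h (k.+1 + 3 * t) x y a b.
Proof.
move=> w; elim: t => [|t IH]; first by rewrite muln0 addn0.
have [z hxyz _] := walkSE w; have [_ _ hyzx hzxy _] := symmetric3_perms hS hxyz.
rewrite (_ : (k.+1 + 3 * t.+1 = (k.+1 + 3 * t).+3)%N); last by lia.
exact: walkS hxyz (walkS hyzx (walkS hzxy IH)).
Qed.

Hypothesis hI : irreflexive3 h.

(* A closed walk of length [k + 1] prime to 3 yields, by spinning around an edge, closed walks of
   all larger lengths in its residue class; undoing all its steps but one gives the opposite
   class. *)
Lemma locally_tripartite_of_no_closed_walk l K : ~~ (3 %| l)%N -> (2 * K + 4 <= l)%N ->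
  ~ closed_walk h l -> locally_tripartite h K.
Proof.
move=> l3 lK no_closed k x y z kK xy w.
have k2 : (2 <= k)%N.
  case: k w {kK} => [/walk0E[_ E]|[|//]]; first by rewrite E eqxx in xy.
  move=> /walkSE[u hxyu /walk0E[_ E]]; move: hxyu.
  by rewrite -E -(symmetric3_rot hS) hI.
apply/negPn/negP => k3.
have [E|E] : (k.+1 = l %[mod 3] \/ 2 * k.-1 + 1 = l %[mod 3])%N by lia.
  case: no_closed; exists x, y, z.
  have -> : l.-1 = (k.-1.+1 + 3 * ((l - k.+1) %/ 3))%N by lia.
  by apply: walk_spin; rewrite prednK// ltnW.
have := walk_back w; rewrite (_ : (2 * k = ((2 * k.-1).-1.+1).+2)%N); last by lia.
move=> /walkSE[u _ /walk_last[v w' _]]; case: no_closed; exists x, u, v.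
have -> : l.-1 = ((2 * k.-1).-1.+1 + 3 * ((l - (2 * k.-1 + 1)) %/ 3))%N by lia.
exact: walk_spin.
Qed.

End SymmetricWalk.

Section TightReach.
Variables (V : finType) (h : V -> V -> V -> bool) (x0 y0 : V).

(* The label [i] records the number of steps modulo 3; it is attached to the first vertex of the
   pair. *)
Definition tight_reach r x y (i : 'Z_3) :=
  exists2 k, (k <= r)%N & walk h k x0 y0 x y /\ i = k%:R.

Definition label r x i :=
  (exists y, tight_reach r x y i) \/ (exists y, tight_reach r y x (i - 1)).

Lemma tight_reach_le r s x y i : (r <= s)%N -> tight_reach r x y i -> tight_reach s x y i.
Proof. by move=> rs [k kr w]; exists k => //; apply: leq_trans rs. Qed.

Lemma tight_reach_step r x y z i :
  tight_reach r x y i -> h x y z -> tight_reach r.+1 y z (i + 1).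
Proof.
move=> [k kr [w ->]] hxyz; exists k.+1 => //.
by split; [apply: walk_rcons w hxyz | rewrite natr1].
Qed.

Lemma label_le r s x i : (r <= s)%N -> label r x i -> label s x i.
Proof. by move=> rs [] [y /(tight_reach_le rs)]; [left | right]; exists y. Qed.

Lemma label_first r x y i : tight_reach r x y i -> label r x i.
Proof. by left; exists y. Qed.

Lemma label_second r x y i : tight_reach r x y i -> label r y (i + 1).
Proof. by right; exists x; rewrite addrK. Qed.

Hypotheses (hS : symmetric3 h) (hI : irreflexive3 h) (xy0 : x0 != y0).

Lemma tight_reach_neq r x y i : tight_reach r x y i -> x != y.
Proof.
move=> [[|k] _ [w _]]; first by have [-> ->] := walk0E w.
by have [u _] := walk_last w; rewrite (symmetric3_rot hS) => /(irreflexive3_neq hI).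
Qed.

Lemma tight_reach_link r s x y i u v j : tight_reach r x y i -> tight_reach s u v j ->
  exists2 k, (k <= 2 * r + s)%N & walk h k x y u v /\ k%:R = j - i.
Proof.
move=> [k kr [w ->]] [k' ks [w' ->]]; exists (2 * k + k')%N; first by lia.
split; first exact: walk_cat (walk_back hS w) w'.
apply/eqP; rewrite -subr_eq0 natrD mulnC natrM mulr_natr mulr2n.
by rewrite opprB addrA addrAC addrK -addrA addrA; elim/Z3_ind: (k%:R).
Qed.

Variable K : nat.
Hypothesis hK : locally_tripartite h K.

Lemma walk_second_first k x y z : (k <= K)%N -> x != y -> walk h k x y z x ->
  k%:R = -1 :> 'Z_3.
Proof.
by move=> kK xy /(hK kK xy); rewrite -natr_Z3_eq0 -natr1 addr_eq0 => /eqP.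
Qed.

Lemma walk_first_first k x y z : (k <= K)%N -> x != y -> walk h k x y x z ->
  k%:R = 0 :> 'Z_3.
Proof.
case: k => [//|k] kK xy /walk_last[w wk _].
by rewrite -natr1 (walk_second_first (ltnW kK) xy wk) addNr.
Qed.

Lemma walk_second_second k x y z : (k <= K)%N -> walk h k x y z y -> k%:R = 0 :> 'Z_3.
Proof.
case: k => [//|k] kK /walkSE[w]; rewrite (symmetric3_rot hS) => /(irreflexive3_neq hI) yw wk.
by rewrite -natr1 (walk_second_first (ltnW kK) yw wk) addNr.
Qed.

Lemma label_uniq r x i j : (3 * r <= K)%N -> label r x i -> label r x j -> i = j.
Proof.
move=> rK; have link k : (k <= 2 * r + r -> k <= K)%N by lia.
have mixed y z i' j' : tight_reach r x y i' -> tight_reach r z x (j' - 1) -> i' = j'.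
  move=> xy zx; have [k /link kK [w E]] := tight_reach_link xy zx.
  have := walk_second_first kK (tight_reach_neq xy) w; rewrite E => /eqP.
  by rewrite addrAC -[X in _ == X]add0r (inj_eq (addIr _)) subr_eq0 => /eqP.
move=> [] [y xi] [] [z xj].
- have [k /link kK [w E]] := tight_reach_link xi xj.
  have := walk_first_first kK (tight_reach_neq xi) w; rewrite E => /eqP.
  by rewrite subr_eq0 => /eqP.
- exact: mixed xi xj.
- exact/esym/(mixed _ _ _ _ xj xi).
have [k /link kK [w E]] := tight_reach_link xi xj.
have := walk_second_second kK w; rewrite E => /eqP.
by rewrite subr_eq0 (inj_eq (addIr _)) => /eqP.
Qed.

End TightReach.

(** * Subgraphs of large codegree *)

Section Cleaning.
Variables (R : realFieldType) (V : finType).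
Implicit Types h : V -> V -> V -> bool.
Local Notation density := (density R).
Local Notation density2 := (density2 R).
Local Notation density3 := (density3 R).

Definition same_pair (x y a b : V) := (a == x) && (b == y) || (a == y) && (b == x).

Definition delete_pair h x y a b c :=
  [&& h a b c, ~~ same_pair x y a b, ~~ same_pair x y b c & ~~ same_pair x y a c].

Definition shadow h x y := [exists z, h x y z].

Lemma same_pairC x y a b : same_pair x y a b = same_pair x y b a.
Proof. by rewrite /same_pair orbC ![(_ == x) && _]andbC. Qed.

Lemma delete_pair_sub h x y a b c : delete_pair h x y a b c -> h a b c.
Proof. by case/andP. Qed.

Lemma symmetric3_delete_pair h x y : symmetric3 h -> symmetric3 (delete_pair h x y).
Proof.
move=> hS; apply: symmetric3_swaps => a b c; rewrite /delete_pair.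
  by rewrite (symmetric3_swap hS) (same_pairC _ _ a b) [~~ same_pair _ _ b c && _]andbC.
rewrite (symmetric3_swap23 hS) (same_pairC _ _ b c); congr (_ && _).
by do 3!case: (same_pair _ _ _ _).
Qed.

Lemma density3_delete_pair h x y : symmetric3 h ->
  density3 h <= density3 (delete_pair h x y) + 6 * (density (h x y) / #|V|%:R ^+ 2).
Proof.
move=> hS; pose lost a b c := same_pair x y a b && h a b c.
pose at_xy a b c := [&& a == x, b == y & h x y c].
have at_xyE : density3 at_xy = density (h x y) / #|V|%:R ^+ 2.
  by rewrite density3M !density_pred1 expr2 invfM mulrC mulrA.
have lost_le : density3 lost <= 2 * density3 at_xy.
  rewrite mulr_natl mulr2n -{2}(density3_swap R at_xy); apply: density3_leU => a b c.
  rewrite /at_xy => /andP[/orP[]/andP[/eqP-> /eqP->] habc]; first by rewrite !eqxx habc.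
  by rewrite !eqxx (symmetric3_swap hS) habc orbT.
have lost3 : density3 (fun a b c => h a b c && ~~ delete_pair h x y a b c) <=
    density3 lost + density3 (fun a b c => lost b c a) + density3 (fun a b c => lost a c b).
  apply: density3_leU3 => a b c /andP[habc].
  rewrite /delete_pair /lost habc -(symmetric3_rot hS) habc -(symmetric3_swap23 hS) habc /=.
  by rewrite !andbT -!negb_or negbK orbA.
have lost_rot : density3 (fun a b c => lost b c a) = density3 lost by exact: density3_rot.
have lost_swap : density3 (fun a b c => lost a c b) = density3 lost.
  by rewrite -(density3_rot R lost) -[RHS]density3_swap.
have : density3 h <= density3 (delete_pair h x y) +
    density3 (fun a b c => h a b c && ~~ delete_pair h x y a b c).
  by apply: density3_leU => a b c ->; rewrite orbN.
by move: lost3; rewrite lost_rot lost_swap -at_xyE; lra.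
Qed.

Lemma shadow_delete_pair h x y : shadow h x y ->
  density2 (shadow (delete_pair h x y)) + (#|V|%:R ^+ 2)^-1 <= density2 (shadow h).
Proof.
move=> sxy; rewrite /density2 !density_card card_prod -[X in _ + X]div1r natrM expr2 -mulrDl.
rewrite ler_wpM2r ?invr_ge0 ?mulr_ge0// natr1 ler_nat; apply: proper_card.
apply/properP; split; first last.
  exists (x, y) => //; apply/negP => /existsP[z /and4P[_]].
  by rewrite /same_pair !eqxx.
by apply/fintype.subsetP => -[a b] /existsP[c /delete_pair_sub habc]; apply/existsP; exists c.
Qed.

(* Deleting all edges over a pair of positive codegree less than [delta] loses a density of at most
   [6 delta / n ^ 2] and removes the pair from the shadow. *)
Lemma exists_large_codegree_subgraph_shadow h delta : symmetric3 h -> exists h', [/\ symmetric3 h',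
  forall x y z, h' x y z -> h x y z, forall x y z, h' x y z -> delta <= density (h' x y) &
  density3 h - 6 * delta * density2 (shadow h) <= density3 h' - 6 * delta * density2 (shadow h')].
Proof.
have [m] := ubnP #|[set p | shadow h p.1 p.2]|; elim: m h => // m IH h hm hS.
have [/existsP[[x y] /andP[/= sxy small]]|/existsPn large] :=
    boolP [exists p, shadow h p.1 p.2 && (density (h p.1 p.2) < delta)]; last first.
  exists h; split=> // x y z hxyz; have := large (x, y).
  by rewrite /= negb_and -leNgt => /orP[/existsPn/(_ z)/negP|].
have [||h' [hS' sub codeg loss]] := IH (delete_pair h x y).
- move: hm; rewrite !cardsE ltnS; apply: leq_trans; apply: proper_card.
  apply/properP; split.
    by apply/fintype.subsetP => -[a b] /existsP[c /delete_pair_sub ?]; apply/existsP; exists c.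
  exists (x, y) => //; apply/negP => /existsP[z /and4P[_]].
  by rewrite /same_pair !eqxx.
- exact: symmetric3_delete_pair.
exists h'; split=> //; first by move=> a b c /sub/delete_pair_sub.
apply: le_trans loss.
have := density3_delete_pair x y hS; have := shadow_delete_pair sxy.
have : density (h x y) / #|V|%:R ^+ 2 <= delta / #|V|%:R ^+ 2.
  by rewrite ler_wpM2r ?invr_ge0 ?exprn_ge0// ltW.
have : 0 <= delta by apply: le_trans (ltW small); apply: density_ge0.
by set N := _^-1; nra.
Qed.

Lemma exists_large_codegree_subgraph h delta : symmetric3 h -> 0 <= delta ->
  exists h', [/\ symmetric3 h', forall x y z, h' x y z -> h x y z,
    forall x y z, h' x y z -> delta <= density (h' x y) &
  density3 h - 6 * delta <= density3 h'].
Proof.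
move=> hS d0; have [h' [hS' sub codeg loss]] := exists_large_codegree_subgraph_shadow delta hS.
exists h'; split=> //.
have := density_le1 R (fun p => shadow h p.1 p.2); rewrite -/(density2 (shadow h)).
have := density2_ge0 R (shadow h'); nra.
Qed.

End Cleaning.

(** * Tight components *)

Section Diameter.
Variables (R : realFieldType) (V : finType) (h : V -> V -> V -> bool) (delta : R).
Hypotheses (hS : symmetric3 h) (delta_gt0 : 0 < delta).
Hypothesis codeg : forall x y z, h x y z -> delta <= density R (h x y).
Local Notation density := (density R).
Local Notation density2 := (density2 R).

Definition walk_ball x y r a b := `[<exists2 k, (k <= r)%N & walk h k x y a b>].

Lemma density2_two_steps a b c : h a b c ->
  delta ^+ 2 <= density2 (fun u v => h a b u && h b u v).
Proof.
move=> habc; apply: (@le_trans _ _ (density (h a b) * delta)).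
  by rewrite expr2 ler_pM2r//; apply: codeg habc.
rewrite density2E -avgZr; apply: le_avg => u; case: (boolP (h a b u)) => [habu|_] /=.
  by rewrite mul1r; apply: codeg; rewrite -(symmetric3_rot hS); eassumption.
by rewrite mul0r density_ge0.
Qed.

(* A pair two steps away from [c, d] leads back to it in four steps, so it is not in the smaller
   ball. *)
Lemma walk_ball_growth x y r n c d e : (r + 4 < n)%N -> walk h n x y c d ->
  (forall k, walk h k x y c d -> (n <= k)%N) -> h c d e ->
  density2 (walk_ball x y r) + delta ^+ 2 <= density2 (walk_ball x y n.+2).
Proof.
move=> rn w geodesic hcde; apply: le_trans (lerD (lexx _) (density2_two_steps hcde)) _.
rewrite -density_disjointU => [|[u v] /= /asboolP[k kr wk]]; last first.
  apply/negP => /andP[hcdu hduv].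
  have back := walk_back hS (walk_rcons (walk1 hcdu) hduv).
  by have := geodesic _ (walk_cat wk back); lia.
apply: le_density => -[u v] /= /orP[/asboolP[k kr wk]|/andP[hcdu hduv]]; apply/asboolP.
  by exists k => //; lia.
by exists n.+2 => //; apply: walk_rcons (walk_rcons w hcdu) hduv.
Qed.

Lemma exists_geodesic x y a b k N : walk h k x y a b ->
  ~ (exists2 k', (k' <= N)%N & walk h k' x y a b) -> forall n, (n <= N)%N ->
  exists c d, walk h n x y c d /\ forall k', walk h k' x y c d -> (n <= k')%N.
Proof.
move=> w far n nN.
have ex : exists k, `[<walk h k x y a b>] by exists k; apply/asboolP.
case: (ex_minnP ex) => m /asboolP wm min_m.
have Nm : (N < m)%N by rewrite ltnNge; apply/negP => mN; apply: far; exists m.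
have mE : m = (n + (m - n))%N by lia.
rewrite mE in wm; have [c [d [w1 w2]]] := walk_split wm.
exists c, d; split=> // k' w'.
by have := min_m _ (introT (asboolP _) (walk_cat w' w2)); lia.
Qed.

Lemma walk_end_edge x y z k c d : h x y z -> walk h k x y c d -> exists e, h c d e.
Proof.
move=> hxyz; case: k => [/walk0E[-> ->]|k /walk_last[e _ he]]; first by exists z.
by exists e; rewrite -(symmetric3_rot hS).
Qed.

Lemma tight_diameter x y z D a b k : h x y z -> 1 < D%:R * delta ^+ 2 ->
  walk h k x y a b -> exists2 k', (k' <= 7 * D)%N & walk h k' x y a b.
Proof.
move=> hxyz D_big w; apply: contrapT => far.
have delta2 : 0 < delta ^+ 2 by rewrite exprn_gt0.
suff grow m : (m <= D)%N -> m.+1%:R * delta ^+ 2 <= density2 (walk_ball x y (7 * m).+2).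
  have := grow D (leqnn _); rewrite -natr1 mulrDl mul1r.
  by have := density_le1 R (fun p => walk_ball x y (7 * D).+2 p.1 p.2); rewrite -/(density2 _); lra.
elim: m => [_|m IH mD].
  rewrite mul1r; apply: le_trans (density2_two_steps hxyz) _.
  apply: le_density2 => u v /andP[hxyu hyuv]; apply/asboolP; exists 2%N => //.
  exact: walk_rcons (walk1 hxyu) hyuv.
have [c [d [wcd geodesic]]] := exists_geodesic w far (leq_mul (leqnn 7) mD).
have [e hcde] := walk_end_edge hxyz wcd.
rewrite -natr1 mulrDl mul1r; apply: le_trans (lerD (IH (ltnW mD)) (lexx _)) _.
by apply: walk_ball_growth wcd geodesic hcde; lia.
Qed.

End Diameter.

Section TightComponents.
Variables (R : realFieldType) (V : finType) (h : V -> V -> V -> bool).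
Hypothesis hS : symmetric3 h.

Definition tightly_connected x y a b := exists k, walk h k x y a b.

Definition tight_component x y : {set V * V} :=
  [set q : V * V | `[<tightly_connected x y q.1 q.2>]].

Definition component_colour x y : option {set V * V} :=
  if shadow h x y then Some (tight_component x y :|: tight_component y x) else None.

Lemma tightly_connected_sym x y a b : tightly_connected x y a b -> tightly_connected a b x y.
Proof. by move=> [k /(walk_back hS) w]; exists (2 * k)%N. Qed.

Lemma tightly_connected_trans x y a b c d :
  tightly_connected x y a b -> tightly_connected a b c d -> tightly_connected x y c d.
Proof. by move=> [k w] [k' w']; exists (k + k')%N; apply: walk_cat w w'. Qed.

Lemma tightly_connected_rev x y a b : tightly_connected x y a b -> tightly_connected b a y x.
Proof. by move=> [k /(walk_rev hS)]; exists k. Qed.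

Lemma tight_component_connected x y a b :
  tightly_connected x y a b -> tight_component x y = tight_component a b.
Proof.
move=> c; apply/setP => q; rewrite !inE; apply/asboolP/asboolP.
  exact: tightly_connected_trans (tightly_connected_sym c).
exact: tightly_connected_trans c.
Qed.

Lemma component_colourC x y : component_colour x y = component_colour y x.
Proof.
rewrite /component_colour finset.setUC; congr (if _ then _ else _).
by apply/existsP/existsP => -[z]; rewrite (symmetric3_swap hS); exists z.
Qed.

Lemma component_colour_edge x y z :
  h x y z -> component_colour x y = Some (tight_component x y :|: tight_component y x).
Proof.
by move=> hxyz; rewrite /component_colour (_ : shadow h x y) //; apply/existsP; exists z.
Qed.

Lemma component_colour_rot x y z : h x y z -> component_colour x y = component_colour y z.
Proof.
move=> hxyz; have [_ _ hyzx _ hzyx] := symmetric3_perms hS hxyz.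
rewrite (component_colour_edge hxyz) (component_colour_edge hyzx).
have -> : tight_component x y = tight_component y z.
  by apply: tight_component_connected; exists 1%N; apply: walk1.
have -> // : tight_component z y = tight_component y x.
by apply: tight_component_connected; exists 1%N; apply: walk1.
Qed.

Lemma mono_edge x y z : h x y z -> mono component_colour x y z.
Proof.
move=> hxyz; have [_ _ hyzx _ _] := symmetric3_perms hS hxyz.
have xyE := component_colour_rot hxyz; have yzE := component_colour_rot hyzx.
rewrite /mono /corner (component_colourC y x) (component_colourC x z) -yzE -xyE.
by rewrite (component_colour_edge hxyz) eq_SomeP eqxx.
Qed.

Lemma component_colour_connected x y a b j : component_colour x y = Some j ->
  component_colour a b = Some j -> tightly_connected x y a b \/ tightly_connected y x a b.
Proof.
rewrite /component_colour; case: ifP => // _ [<-]; case: ifP => // _ [] /setP/(_ (a, b)).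
rewrite !inE /= => E; have : `[<tightly_connected a b a b>] || `[<tightly_connected b a a b>].
  by apply/orP; left; apply/asboolP; exists 0%N; apply: walk0.
by rewrite E => /orP[]/asboolP; [left | right].
Qed.

Variables (delta : R) (D K : nat).
Hypotheses (hI : irreflexive3 h) (delta_gt0 : 0 < delta).
Hypothesis codeg : forall x y z, h x y z -> delta <= density R (h x y).
Hypotheses (D_big : 1 < D%:R * delta ^+ 2) (DK : (3 * (7 * D) <= K)%N).
Hypothesis hK : locally_tripartite h K.

Definition oriented x0 y0 (f : V -> 'Z_3) x y :=
  tight_reach h x0 y0 (7 * D) x y (f x) /\ f y = f x + 1.

Lemma exists_oriented x0 y0 z0 : h x0 y0 z0 ->
  exists f, forall x y, tightly_connected x0 y0 x y -> oriented x0 y0 f x y.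
Proof.
move=> h0; have xy0 := irreflexive3_neq hI h0.
have /choice[f f_label] v : exists i, forall i', label h x0 y0 (7 * D) v i' -> i' = i.
  case: (pselect (exists i, label h x0 y0 (7 * D) v i)) => [[i vi]|no].
    by exists i => i' vi'; apply: (label_uniq hS hI xy0 hK DK vi' vi).
  by exists 0 => i' vi'; case: no; exists i'.
exists f => x y [k w]; have [k' kD w'] := tight_diameter hS delta_gt0 codeg h0 D_big w.
have xy : tight_reach h x0 y0 (7 * D) x y k'%:R by exists k'.
by rewrite /oriented -(f_label _ _ (label_first xy)) -(f_label _ _ (label_second xy)).
Qed.

Lemma exists_component_part j : exists f, (forall x y, component_colour x y <> Some j) \/
  exists x0 y0, x0 != y0 /\ forall x y, component_colour x y = Some j ->
    oriented x0 y0 f x y \/ oriented x0 y0 f y x.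
Proof.
case: (pselect (exists x0 y0, component_colour x0 y0 = Some j)) => [[x0 [y0 xy0j]]|no]; last first.
  by exists (fun=> 0); left => x y xyj; apply: no; exists x, y.
have [z0 h0] : exists z, h x0 y0 z.
  by apply/existsP; move: xy0j; rewrite /component_colour; case: ifP.
have [f f_oriented] := exists_oriented h0.
exists f; right; exists x0, y0; split; first exact: irreflexive3_neq hI h0.
move=> x y /(component_colour_connected xy0j)[xy|/tightly_connected_rev yx]; [left|right].
  exact: f_oriented.
exact: f_oriented (tightly_connected_sym yx).
Qed.

End TightComponents.

Definition reached (V : finType) (h : V -> V -> V -> bool) x0 y0 r x y i :=
  `[<tight_reach h x0 y0 r x y i>].

Definition near_tripartition (R : realFieldType) (V : finType) (h : V -> V -> V -> bool)
    x0 y0 r rho (G : 'Z_3 -> pred V) :=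
  [/\ density R (fun x => ~~ [exists i, G i x]) <= rho,
      forall i, `|density R (G i) - 1 / 3| <= 2 * rho &
      forall i x, G i x ->
        density R (fun y => G (i + 1) y && ~~ reached h x0 y0 r x y i) <= rho].

Theorem exists_near_tripartition (R : realFieldType) (rho : R) (D K : nat) (V : finType)
    (h : V -> V -> V -> bool) :
  0 < rho -> rho <= (1 / 50) ^+ 2 ->
  1 < D%:R * (rho ^+ 4 / 24) ^+ 2 -> (3 * (7 * D) <= K)%N ->
  symmetric3 h -> irreflexive3 h -> locally_tripartite h K -> 1 / 4 <= density3 R h ->
  exists x0 y0 G, x0 != y0 /\ near_tripartition h x0 y0 (7 * D) rho G.
Proof.
move=> rho_gt0 rho_small D_big DK hS hI hK dense.
have delta_gt0 : 0 < rho ^+ 4 / 24 by rewrite divr_gt0 ?exprn_gt0.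
have [h' [hS' sub codeg loss]] := exists_large_codegree_subgraph hS (ltW delta_gt0).
have hI' := irreflexive3_sub sub hI; have hK' := locally_tripartite_sub sub hK.
have /choice[part partP] := exists_component_part hS' hI' delta_gt0 codeg D_big DK hK'.
pose col := component_colour h'.
have part_neq j x y : col x y = Some j -> part j x != part j y.
  move=> xyj; case: (partP j) => [/(_ _ _ xyj)//|[x0 [y0 [_ /(_ _ _ xyj)]]]].
  by case=> -[_ ->]; [rewrite eq_sym|]; apply: Z3_succ_neq.
have many_mono : 1 / 4 - rho ^+ 4 / 4 <= density3 R (mono col).
  apply: le_trans (_ : density3 R h' <= _); first by lra.
  by apply: le_density3 => x y z; apply: mono_edge.
have [j [G [Gpart cover size adj]]] :=
  mono_triangle_stability (component_colourC hS') part_neq rho_gt0 rho_small many_mono.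
have [x0 [y0 [xy0 reachP]]] : exists x0 y0, x0 != y0 /\ forall x y, col x y = Some j ->
    oriented h' D x0 y0 (part j) x y \/ oriented h' D x0 y0 (part j) y x.
  case: (partP j) => [no|//]; exfalso.
  have big i : 1 / 4 <= density R (G i) by have := size i; rewrite ler_norml => /andP[]; lra.
  have [x Gx] : exists x, G 0 x by apply: (@density_gt0 R); apply: lt_le_trans (big 0); lra.
  have := adj 0 1 x isT Gx; rewrite (eq_density R (Q := G 1)); first by have := big 1; lra.
  by move=> y; case: eqP => [/no//|]; rewrite andbT.
exists x0, y0, G; split=> //; split=> //.
- apply: le_trans cover; apply: le_density => x; apply: contra => Gx.
  by apply/existsP; exists (part j x).
move=> i x Gx; apply: le_trans (adj i (i + 1) x _ Gx); last by rewrite eq_sym Z3_succ_neq.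
apply: le_density => y /andP[Gy]; rewrite Gy /=; apply: contraNN => /eqP xyj; apply/asboolP.
case: (reachP _ _ xyj) => -[reach]; rewrite (Gpart _ _ Gx) (Gpart _ _ Gy) in reach *.
  by move=> _; case: reach => k kr [w ->]; exists k => //; split=> //; apply: walk_sub w.
by rewrite Z3_addr11 => /eqP; rewrite eq_sym (negbTE (Z3_pred_neq i)).
Qed.

(** * Links and the exact tripartition *)

Lemma mantel_density (R : realFieldType) (V : finType) (W : pred V) (g : rel V) :
  symmetric g -> (forall x y z, W x -> W y -> W z -> g x y -> g x z -> ~~ g y z) ->
  density2 R (fun x y => [&& W x, W y & g x y]) <= density R W ^+ 2 / 2.
Proof.
move=> gC triangle_free; case: (pickP W) => [x0 Wx0|W0]; last first.
  by rewrite [density2 _ _]density_pred0 ?divr_ge0 ?sqr_ge0// => p; rewrite W0.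
pose deg x := density R (fun y => W y && g x y).
have [x Wx deg_max] := arg_maxP deg Wx0.
pose Q u := W u && ~~ g x u; pose eQ u v := [&& Q u, W v & g u v].
have eQ_le : density2 R eQ <= density R Q * deg x.
  rewrite density2E -avgZr; apply: le_avg => u; case: (boolP (Q u)) => [/andP[Wu _]|nQu].
    by rewrite mul1r; apply: le_trans (deg_max u Wu); apply: le_density => v /and3P[_ ->].
  by rewrite mul0r density_pred0// => v; rewrite /eQ (negbTE nQu).
have : density2 R (fun x y => [&& W x, W y & g x y]) <=
    density2 R eQ + density2 R (fun u v => eQ v u).
  apply: density2_leU => u v /and3P[Wu Wv guv]; have gvu : g v u by rewrite gC.
  rewrite /eQ /Q Wu Wv guv gvu /= !andbT.
  rewrite -negb_and; apply/negP => /andP[xu xv].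
  by have := triangle_free x u v Wx Wu Wv xu xv; rewrite guv.
rewrite (density2C R eQ); have : density R W = deg x + density R Q by apply: density_splitC.
by move=> ->; have := sqr_ge0 (deg x - density R Q); rewrite !expr2; lra.
Qed.

(* The link density [1 / 4] is almost attained by a complete bipartite link between two parts of
   density [1 / 3], but not when [a] and [b] of these parts are diverted; [67 / 200] is [1 / 3]
   plus the allowed error. *)
Lemma diverted_le (R : realFieldType) (a b : R) : let g := 67 / 200 in
  0 <= a <= g -> 0 <= b <= g ->
  1 / 4 - 1 / 250 <= g ^+ 2 / 2 + a ^+ 2 / 2 + b ^+ 2 / 2 + 2 * ((g - a) * (g - b)) ->
  a + b <= 3 / 40.
Proof.
move=> g /andP[a0 ag] /andP[b0 bg] dense; rewrite leNgt; apply/negP => large.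
have := sqr_ge0 (a - b).
have : 0 <= (a + b - 3 / 40) * ((g - a) + (g - b)).
  by apply: mulr_ge0; [rewrite subr_ge0 ltW | rewrite addr_ge0 ?subr_ge0].
by move: dense; rewrite /g !expr2; lra.
Qed.

Section Link.
Variables (R : realFieldType) (V : finType) (h : V -> V -> V -> bool) (K r : nat).
Variables (rho : R) (x0 y0 : V) (G : 'Z_3 -> pred V).
Hypotheses (hS : symmetric3 h) (hI : irreflexive3 h) (hK : locally_tripartite h K).
Hypotheses (xy0 : x0 != y0) (rK : (3 * (r + 10) <= K)%N).

Let label_uniq_near s x i k : (s <= r + 10)%N ->
  label h x0 y0 s x i -> label h x0 y0 s x k -> i = k.
Proof. by move=> sr; apply: (label_uniq hS hI xy0 hK); lia. Qed.

Let le_r3 : (r <= r.+3)%N. Proof. by lia. Qed.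

Let le_r3_10 : (r.+3 <= r + 10)%N. Proof. by lia. Qed.

Lemma link_triangle_free d x y z : h d x y -> h d x z -> ~~ h d y z.
Proof.
move=> dxy dxz; apply/negP => dyz.
have [_ _ _ _ yxd] := symmetric3_perms hS dxy; have [_ xdz _ _ _] := symmetric3_perms hS dxz.
have [dzy _ _ _ _] := symmetric3_perms hS dyz.
have K3 : (3 <= K)%N by lia.
by have := hK K3 (irreflexive3_neq hI yxd) (walkS yxd (walkS xdz (walk1 dzy))).
Qed.

Hypotheses (rho_gt0 : 0 < rho) (rho_small : rho <= (1 / 50) ^+ 2).
Hypothesis near : near_tripartition h x0 y0 r rho G.
Hypothesis min_degree : forall d, 1 / 4 <= density2 R (h d).

Local Notation density := (density R).
Local Notation density2 := (density2 R).
Local Notation reached := (reached h x0 y0).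
Local Notation label := (label h x0 y0).
Local Notation uncovered := (fun x => ~~ [exists i, G i x]).

Let G_size i : 1 / 3 - 2 * rho <= density (G i) <= 1 / 3 + 2 * rho.
Proof.
by have [_ /(_ i) + _] := near; rewrite ler_norml => /andP[? ?]; apply/andP; split; lra.
Qed.

Let G_unreached i x : G i x -> density (fun y => G (i + 1) y && ~~ reached r x y i) <= rho.
Proof. by have [_ _ +] := near; apply. Qed.

Lemma near_tripartition_label i x : G i x -> label r x i.
Proof.
move=> Gx; have [y /andP[_ /asboolP/label_first//]] : exists y, G (i + 1) y && reached r x y i.
apply: (@density_gt0 R); have := G_unreached Gx.
have := density_splitC R (G (i + 1)) (fun y => reached r x y i).
by have /andP[+ _] := G_size (i + 1); have := rho_small; lra.
Qed.

Definition inside_link d i : R := density2 (fun x y => [&& G i x, G i y & h d x y]).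

Definition across_link d i : R :=
  density2 (fun x y => [&& G i x, G (i + 1) y, reached r x y i & h d x y]).

Lemma forward_link_le d :
  density2 (fun x y => [exists i, [&& G i x, G (i + 1) y & h d x y]]) <=
  \sum_i across_link d i + 3 * rho.
Proof.
apply: le_trans (_ : _ <= \sum_i density2 (fun x y => [&& G i x, G (i + 1) y & h d x y])) _.
  apply: density_le_bigU => -[x y] /existsP[i xy]; by exists i.
have unreached_le i : density2 (fun x y => [&& G i x, G (i + 1) y & ~~ reached r x y i]) <= rho.
  rewrite density2E; apply: avg_le => [|x]; first exact: ltW.
  case: (boolP (G i x)) => [/G_unreached//|_].
  by rewrite density_pred0 ?ltW.
apply: (@le_trans _ _ (\sum_i (across_link d i + rho))).
  apply: ler_sum => i _; apply: le_trans (lerD (lexx _) (unreached_le i)).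
  apply: density2_leU => x y /and3P[-> -> ->].
  by rewrite !andbT /= orbN.
by rewrite big_split sumr_const card_ord /= -[rho *+ _]mulr_natl.
Qed.

Lemma link_bound d :
  density2 (h d) <= \sum_i inside_link d i + 2 * \sum_i across_link d i + 8 * rho.
Proof.
have V_gt0 : (0 < #|V|)%N by apply/card_gt0P; exists d.
pose fwd x y := [exists i, [&& G i x, G (i + 1) y & h d x y]].
pose ins x y := [exists i, [&& G i x, G i y & h d x y]].
have ins_le : density2 ins <= \sum_i inside_link d i.
  by apply: density_le_bigU => -[x y] /existsP[i xy]; exists i.
have cover : density uncovered <= rho by have [] := near.
have : density2 (fun x y => fwd x y || fwd y x) <= density2 fwd + density2 (fun x y => fwd y x).
  exact: density2_leU.
have : density2 (fun x y => uncovered x || uncovered y) <= rho + rho.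
  apply: le_trans (lerD cover cover).
  by rewrite -{1}(density2_fst _ _ V_gt0) -(density2_snd R uncovered V_gt0); apply: density2_leU.
have : density2 (h d) <= density2 (fun x y => uncovered x || uncovered y) +
    density2 ins + density2 (fun x y => fwd x y || fwd y x).
  apply: density2_leU3 => x y dxy.
  case: (boolP (uncovered x)) => //= /negPn/existsP[i Gx].
  case: (boolP (uncovered y)) => //= /negPn/existsP[k Gy].
  have dyx : h d y x by rewrite (symmetric3_swap23 hS).
  case: (Z3_cases i k) => E; rewrite E in Gy.
  - by apply/orP; left; apply/existsP; exists i; rewrite Gx Gy.
  - by apply/or3P/Or32; apply/existsP; exists i; rewrite Gx Gy.
  - by apply/or3P/Or33; apply/existsP; exists (i - 1); rewrite subrK Gx Gy.
by rewrite (density2C R fwd); have := forward_link_le d; rewrite -/fwd; lra.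
Qed.

Lemma inside_link_le d i (W : pred V) :
  (forall x y, G i x -> G i y -> h d x y -> W x) -> inside_link d i <= density W ^+ 2 / 2.
Proof.
move=> GW; have dC : symmetric (h d) by move=> x y; rewrite (symmetric3_swap23 hS).
apply: le_trans (@mantel_density R V W (h d) dC _).
  apply: le_density2 => x y /and3P[Gx Gy dxy].
  by rewrite dxy (GW x y)// (GW y x)// dC.
by move=> x y z _ _ _; apply: link_triangle_free.
Qed.

(* The third vertex of an edge over a pair labelled [i + 1] gets the label [i + 3 = i]. *)
Definition labelled d i := exists x y, tight_reach h x0 y0 r x y (i + 1) /\ h x y d.

Lemma labelled_label d i : labelled d i -> label r.+1 d i.
Proof.
by move=> [x [y [xy xyd]]]; have := label_second (tight_reach_step xy xyd); rewrite Z3_addr111.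
Qed.

Lemma labelled_uniq d i k : labelled d i -> labelled d k -> i = k.
Proof. by move=> /labelled_label di /labelled_label; apply: label_uniq_near di; lia. Qed.

Lemma across_link_eq0 d i : ~ labelled d (i - 1) -> across_link d i = 0.
Proof.
move=> no; apply: density_pred0 => -[x y] /=; apply/negP => /and4P[_ _ /asboolP xy dxy].
have [_ _ xyd _ _] := symmetric3_perms hS dxy.
by case: no; exists x, y; rewrite subrK.
Qed.

Lemma labelled_exists d : exists i, labelled d i.
Proof.
apply: contrapT => no.
have across0 i : across_link d i = 0 by apply: across_link_eq0 => di; case: no; exists (i - 1).
have inside i : inside_link d i <= 1 / 15.
  apply: le_trans (@inside_link_le d i (G i) _) _; first by [].
  have /andP[_ hi] := G_size i; have := density_ge0 R (G i); have := rho_small.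
  rewrite expr2; nra.
have := min_degree d; have := link_bound d.
rewrite (sum_Z3 _ 0) (sum_Z3 _ 0) !across0.
have := inside 0; have := inside (0 + 1); have := inside (0 - 1).
by have := rho_small; lra.
Qed.

Lemma inside_link_le_unreached_from d i :
  inside_link d (i + 1) <= density (fun x => G (i + 1) x && ~~ reached r.+2 d x i) ^+ 2 / 2.
Proof.
apply: inside_link_le => x y Gx Gy dxy; rewrite Gx /=; apply/negP => /asboolP dx.
have y2 := label_second (tight_reach_step dx dxy).
have y1 := label_le le_r3 (near_tripartition_label Gy).
by have /eqP := label_uniq_near le_r3_10 y1 y2; rewrite eq_sym (negbTE (Z3_succ_neq _)).
Qed.

Lemma inside_link_le_unreached_to d i :
  inside_link d (i - 1) <= density (fun x => G (i - 1) x && ~~ reached r.+2 x d (i - 1)) ^+ 2 / 2.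
Proof.
apply: inside_link_le => x y Gx Gy dxy; rewrite Gx /=; apply/negP => /asboolP xd.
have [_ xdy _ _ _] := symmetric3_perms hS dxy.
have y2 := label_second (tight_reach_step xd xdy).
have y1 := label_le le_r3 (near_tripartition_label Gy).
have /eqP := label_uniq_near le_r3_10 y1 y2; rewrite Z3_addr11.
by rewrite eq_sym (negbTE (Z3_pred_neq _)).
Qed.

Lemma across_link_le d i : across_link d (i + 1) <=
  density (fun x => G (i + 1) x && reached r.+2 d x i) *
  density (fun y => G (i - 1) y && reached r.+2 y d (i - 1)).
Proof.
rewrite -density2M; apply: le_density2 => x y /and4P[Gx Gy /asboolP xy dxy].
have [_ _ xyd ydx _] := symmetric3_perms hS dxy.
have yd := tight_reach_step xy xyd; have dx := tight_reach_step yd ydx.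
rewrite Z3_addr111 in dx; rewrite Z3_addr11 in yd Gy.
rewrite Gx Gy /=; apply/andP; split; apply/asboolP => //.
exact: tight_reach_le yd.
Qed.

Lemma labelled_unreached_le d i : labelled d i ->
  density (fun x => G (i + 1) x && ~~ reached r.+2 d x i) +
  density (fun y => G (i - 1) y && ~~ reached r.+2 y d (i - 1)) <= 3 / 40.
Proof.
move=> di; set a := density _; set b := density _.
have across0 k : k != i + 1 -> across_link d k = 0.
  move=> ki; apply: across_link_eq0 => dk; move: ki.
  by rewrite -(labelled_uniq dk di) subrK eqxx.
have a0 : 0 <= a by apply: density_ge0.
have b0 : 0 <= b by apply: density_ge0.
have aE := density_splitC R (G (i + 1)) (fun x => reached r.+2 d x i).
have bE := density_splitC R (G (i - 1)) (fun y => reached r.+2 y d (i - 1)).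
rewrite -/a in aE; rewrite -/b in bE.
have size k : density (G k) <= 67 / 200.
  by have /andP[_] := G_size k; have := rho_small; lra.
pose g : R := 67 / 200.
have across_le : across_link d (i + 1) <= (g - a) * (g - b).
  apply: le_trans (across_link_le d i) _; apply: ler_pM; rewrite ?density_ge0//.
    by have := size (i + 1); rewrite /g; lra.
  by have := size (i - 1); rewrite /g; lra.
have inside_le : inside_link d i <= g ^+ 2 / 2.
  apply: le_trans (@inside_link_le d i (G i) _) _; first by [].
  by have := size i; have := density_ge0 R (G i); rewrite !expr2 /g; nra.
apply: diverted_le.
- by rewrite a0 (le_trans _ (size (i + 1)))// aE lerDr density_ge0.
- by rewrite b0 (le_trans _ (size (i - 1)))// bE lerDr density_ge0.
have := min_degree d; have := link_bound d; rewrite !(sum_Z3 _ i).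
rewrite (across0 i) 1?eq_sym ?Z3_succ_neq// (across0 (i - 1)); last first.
  by rewrite eq_sym Z3_succ_neq_pred.
have := inside_link_le_unreached_from d i; have := inside_link_le_unreached_to d i.
rewrite -/a -/b; move: inside_le across_le; rewrite /g; have := rho_small; lra.
Qed.

End Link.

Section Partition.
Variables (R : realFieldType) (V : finType) (h : V -> V -> V -> bool) (K r : nat).
Variables (x0 y0 : V) (part : V -> 'Z_3).
Hypotheses (hS : symmetric3 h) (hI : irreflexive3 h) (hK : locally_tripartite h K).
Hypotheses (xy0 : x0 != y0) (rK : (3 * (r + 10) <= K)%N).
Local Notation density := (density R).
Local Notation density2 := (density2 R).
Local Notation density3 := (density3 R).
Local Notation reached := (reached h x0 y0).
Local Notation label := (label h x0 y0).

Definition unreached s x y :=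
  (part y == part x + 1) && ~~ reached s x y (part x) ||
  (part x == part y + 1) && ~~ reached s y x (part y).

Definition crossing x y z := [&& part x != part y, part y != part z & part x != part z].

Definition missing x y z := crossing x y z && ~~ h x y z.

Definition apex z x y := [&& h z x y, part x == part y & part z != part x].

Definition inside i x y z := [&& part x == i, part y == i, part z == i & h x y z].

Let le_r3 : (r.+3 <= r + 4)%N. Proof. by lia. Qed.

Let le_r4 : (r.+4 <= r + 4)%N. Proof. by lia. Qed.

Hypothesis part_label : forall x, label r.+1 x (part x).
Hypothesis unreached_small : forall x, density (unreached r.+2 x) <= 2 / 25.
Hypothesis part_big : forall i, 33 / 100 <= density (fun x => part x == i).

Let label_eq s x i : (r < s <= r + 10)%N -> label s x i -> i = part x.
Proof.
move=> /andP[rs sr] xi; apply: (label_uniq hS hI xy0 hK _ xi (label_le rs (part_label x))).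
by lia.
Qed.

Lemma unreachedC s x y : unreached s x y = unreached s y x.
Proof. exact: orbC. Qed.

Lemma unreached_neq s x y : unreached s x y -> part x != part y.
Proof. by case/orP=> /andP[/eqP-> _]; rewrite ?(eq_sym (part x)) Z3_succ_neq. Qed.

Lemma unreached_le s t x y : (s <= t)%N -> unreached t x y -> unreached s x y.
Proof.
move=> st /orP[]/andP[E far]; apply/orP; [left|right]; rewrite E /=;
  apply: contra far => /asboolP near; apply/asboolP; exact: tight_reach_le near.
Qed.

Lemma violating_unreached x y z : h x y z -> part x = part y -> part z != part x ->
  unreached (r + 4) x z.
Proof.
move=> xyz exy zx; have [xzy _ _ zxy _] := symmetric3_perms hS xyz.
have label_y i : label (r + 4).+1 y i -> i = part x by rewrite exy; apply: label_eq; lia.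
rewrite /unreached; case: (Z3_cases (part x) (part z)) => E; first by rewrite E eqxx in zx.
  rewrite E eqxx /=; apply/orP; left; apply/negP => /asboolP xz.
  have := label_y _ (label_second (tight_reach_step xz xzy)).
  by rewrite Z3_addr11 => /eqP; rewrite (negbTE (Z3_pred_neq _)).
have {}E : part x = part z + 1 by rewrite E subrK.
apply/orP; right; rewrite E eqxx /=; apply/negP => /asboolP zx'.
have := label_y _ (label_second (tight_reach_step zx' zxy)).
by rewrite E => /eqP; rewrite (negbTE (Z3_succ_neq _)).
Qed.

Lemma unreached_edge x y z : unreached (r + 4) x y -> h x y z ->
  part z != part x -> part z != part y -> unreached r.+2 x z.
Proof.
move=> xy_far xyz zx zy; have [xzy _ _ zxy zyx] := symmetric3_perms hS xyz.
apply/negPn/negP => /norP[]; rewrite !negb_and !negbK => xz_near zx_near.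
case/orP: xy_far => /andP[/eqP E /negP]; apply; apply/asboolP.
  have xzE : part x = part z + 1.
    move: zx zy; rewrite E; case: (Z3_cases (part x) (part z)) => ->; rewrite ?eqxx// subrK.
    by [].
  move: zx_near; rewrite xzE eqxx /= => /asboolP zx_near.
  exact: tight_reach_le le_r3 (tight_reach_step zx_near zxy).
have zxE : part z = part x + 1.
  move: zx zy; rewrite E; case: (Z3_cases (part y) (part z)) => ->; rewrite ?eqxx// Z3_addr11.
  by [].
move: xz_near; rewrite zxE eqxx /= => /asboolP xz_near.
have := tight_reach_step (tight_reach_step xz_near xzy) zyx.
rewrite Z3_addr11 E addrK; exact: tight_reach_le le_r4.
Qed.

Lemma density3_crossing : density3 crossing <=
  6 * (density (fun x => part x == 0) * density (fun x => part x == 1) *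
       density (fun x => part x == -1)).
Proof.
pose p i j k x y z := [&& part x == i, part y == j & part z == k].
have pE i j k : density3 (p i j k) = density (fun x => part x == i) *
    density (fun x => part x == j) * density (fun x => part x == k) by apply: density3M.
have : density3 crossing <=
    \sum_i (density3 (p i (i + 1) (i - 1)) + density3 (p i (i - 1) (i + 1))).
  apply: le_trans (_ : _ <= \sum_i density3 (fun x y z =>
    p i (i + 1) (i - 1) x y z || p i (i - 1) (i + 1) x y z)) _; last first.
    by apply: ler_sum => i _; apply: density3_leU.
  apply: density_le_bigU => -[[x y] z] /= /and3P[xy yz xz]; exists (part x) => //.
  move: xy yz xz; rewrite /p eqxx /= ![part x == _]eq_sym.
  by case: (Z3_cases (part x) (part y)) => ->; case: (Z3_cases (part x) (part z)) => ->;
    rewrite !eqxx// ?orbT.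
rewrite (sum_Z3 _ 0) !pE add0r sub0r subrr addNr.
rewrite (_ : 1 + 1 = -1 :> 'Z_3); last by apply/eqP.
rewrite (_ : -1 - 1 = 1 :> 'Z_3); last by apply/eqP.
by move=> le; apply: le_trans le _; rewrite le_eqVlt; apply/orP; left; apply/eqP; ring.
Qed.

Lemma missing_ge : density2 (unreached (r + 4)) / 4 <= density3 missing.
Proof.
rewrite density3_pairE -avgZr; apply: le_avg => -[x y] /=.
case: (boolP (unreached _ x y)) => xy; last by rewrite mul0r density_ge0.
rewrite mul1r; have xy_neq := unreached_neq xy; have [k kx ky] := Z3_exists_third xy_neq.
have : density (fun z => part z == k) <= density (missing x y) + density (unreached r.+2 x).
  apply: density_leU => z /eqP zk; rewrite /missing /crossing xy_neq zk ![_ == k]eq_sym kx ky /=.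
  by case: (boolP (h x y z)) => //= xyz; apply: unreached_edge xyz _ _; rewrite ?zk.
by have := part_big k; have := unreached_small x; lra.
Qed.

Lemma apex_le : density3 apex <= density2 (unreached (r + 4)) * (2 / 25).
Proof.
rewrite density3E density2E -avgZr; apply: le_avg => z.
apply: (@le_trans _ _ (density (unreached (r + 4) z) * density (unreached (r + 4) z))); last first.
  rewrite ler_wpM2l ?density_ge0//; apply: le_trans (unreached_small z).
  by apply: le_density => y; apply: unreached_le; lia.
rewrite -density2M; apply: le_density2 => x y /and3P[zxy /eqP xy zx].
have [_ _ xyz _ yxz] := symmetric3_perms hS zxy.
rewrite unreachedC (violating_unreached xyz)//= unreachedC.
by apply: (violating_unreached (y := x)); rewrite -?xy// (symmetric3_swap hS).
Qed.

Lemma edge_crossing_inside_apex x y z : h x y z -> [|| crossing x y z && h x y z,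
  [exists i, inside i x y z] | [|| apex x y z, apex y x z | apex z x y]].
Proof.
move=> xyz; have [_ yxz _ zxy _] := symmetric3_perms hS xyz.
rewrite /crossing /apex xyz yxz zxy /=.
have [xy|xy] := eqVneq (part x) (part y).
  have [zx|zx] := eqVneq (part z) (part x); last by rewrite !orbT.
  by apply/or3P/Or32/existsP; exists (part x); rewrite /inside -xy zx eqxx xyz.
have [yz|yz] := eqVneq (part y) (part z); first by rewrite /= !orbT.
by have [xz|//] := eqVneq (part x) (part z); rewrite /= !orbT.
Qed.

Theorem partition_bound : density3 h <=
  6 * (density (fun x => part x == 0) * density (fun x => part x == 1) *
       density (fun x => part x == -1)) + \sum_i density3 (inside i).
Proof.
have crossing_h : density3 crossing =
    density3 (fun x y z => crossing x y z && h x y z) + density3 missing.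
  exact: density_splitC.
have inside_le : density3 (fun x y z => [exists i, inside i x y z]) <= \sum_i density3 (inside i).
  by apply: density_le_bigU => t /existsP[i]; exists i.
have apex3 := density3_leU3 R (fun x y z => id : [|| apex x y z, apex y x z | apex z x y] -> _).
rewrite (density3_swap R apex) (density3_rotr R apex) in apex3.
have := density3_leU3 R edge_crossing_inside_apex; have := density3_crossing.
have := missing_ge; have := apex_le.
by have := density2_ge0 R (unreached (r + 4)); lra.
Qed.

End Partition.

Theorem exists_partition_bound (R : realFieldType) (rho : R) (D K : nat) (V : finType)
    (h : V -> V -> V -> bool) :
  0 < rho -> rho <= (1 / 50) ^+ 2 ->
  1 < D%:R * (rho ^+ 4 / 24) ^+ 2 -> (3 * (7 * D + 10) <= K)%N ->
  symmetric3 h -> irreflexive3 h -> locally_tripartite h K -> (0 < #|V|)%N ->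
  (forall d, 1 / 4 <= density2 R (h d)) ->
  exists part : V -> 'Z_3, (forall i, exists x, part x == i) /\
  density3 R h <=
    6 * (density R (fun x => part x == 0) * density R (fun x => part x == 1) *
         density R (fun x => part x == -1)) + \sum_i density3 R (inside h part i).
Proof.
move=> rho_gt0 rho_small D_big DK hS hI hK V_gt0 min_degree.
have dense : 1 / 4 <= density3 R h.
  by rewrite -(avg_cst (1 / 4) V_gt0) density3E; apply: le_avg.
have DK' : (3 * (7 * D) <= K)%N by lia.
have [x0 [y0 [G [xy0 near]]]] :=
  exists_near_tripartition rho_gt0 rho_small D_big DK' hS hI hK dense.
have /choice[part part_labelled] :=
  labelled_exists hS hI hK xy0 DK rho_gt0 rho_small near min_degree.
have part_label x : label h x0 y0 (7 * D).+1 x (part x) by apply: labelled_label.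
have G_part i x : G i x -> part x = i.
  move=> Gx; apply: (label_uniq hS hI xy0 hK _ (part_label x)); first by lia.
  exact: label_le (leqnSn _) (near_tripartition_label rho_small near Gx).
have [cover size _] := near.
have part_big i : 33 / 100 <= density R (fun x => part x == i).
  have : density R (G i) <= density R (fun x => part x == i) by apply: le_density => x /G_part/eqP.
  by have := size i; rewrite ler_norml => /andP[]; lra.
have unreached_small x : density R (unreached h x0 y0 part (7 * D).+2 x) <= 2 / 25.
  have far_le := labelled_unreached_le hS hI hK xy0 DK rho_gt0 rho_small near min_degree
    (part_labelled x).
  have : density R (unreached h x0 y0 part (7 * D).+2 x) <=
    density R (fun y => G (part x + 1) y && ~~ reached h x0 y0 (7 * D).+2 x y (part x)) +
    density R (fun y => G (part x - 1) y && ~~ reached h x0 y0 (7 * D).+2 y x (part x - 1)) +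
    density R (fun y => ~~ [exists i, G i y]).
    apply: density_leU3 => y.
    case: (boolP [exists i, G i y]) => [/existsP[i Gy]|]; last by rewrite !orbT.
    rewrite orbF /unreached (G_part _ _ Gy) => /orP[]/andP[/eqP E far].
      by rewrite -E Gy far.
    by rewrite E addrK Gy far orbT.
  by lra.
exists part; split; last exact: partition_bound hS hI hK xy0 DK part_label unreached_small part_big.
by move=> i; apply: (@density_gt0 R); apply: lt_le_trans (part_big i); lra.
Qed.

(** * The extremal bound for locally tripartite relations *)

Definition nb_triples (V : finType) (h : V -> V -> V -> bool) : nat :=
  #|[pred t : V * V * V | h t.1.1 t.1.2 t.2]|.

Section CountTriples.
Variables (V : finType) (h : V -> V -> V -> bool).

Lemma density3_nb_triples (R : realFieldType) :
  density3 R h = (nb_triples h)%:R / #|V|%:R ^+ 3.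
Proof. by rewrite /density3 density_card !card_prod !natrM !exprS mulr1 mulrA. Qed.

Lemma nb_triples_preim_val (P : {pred V}) :
  nb_triples (preim3 (val : {x in P} -> V) h) =
  nb_triples (fun x y z => [&& x \in P, y \in P, z \in P & h x y z]).
Proof.
have val3_inj : injective (fun t : {x in P} * {x in P} * {x in P} =>
    (val t.1.1, val t.1.2, val t.2)).
  by move=> [[x y] z] [[x' y'] z'] [/val_inj-> /val_inj-> /val_inj->].
rewrite /nb_triples -(card_imset _ val3_inj); apply: eq_card => -[[x y] z].
apply/imsetP/and4P => [[[[x' y'] z'] xyz [-> -> ->]]|[xP yP zP xyz]].
  by split; [exact: valP..|].
by exists (Sub x xP, Sub y yP, Sub z zP).
Qed.

Lemma nb_triples_restrict_le K f : (forall (U : finType) (g : U -> U -> U -> bool),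
    (#|U| < #|V|)%N -> symmetric3 g -> irreflexive3 g -> locally_tripartite g K ->
    (4 * nb_triples g <= f #|U|)%N) ->
  symmetric3 h -> irreflexive3 h -> locally_tripartite h K ->
  forall P : {pred V}, (#|P| < #|V|)%N ->
  (4 * nb_triples (fun x y z => [&& x \in P, y \in P, z \in P & h x y z]) <= f #|P|)%N.
Proof.
move=> IH hS hI hK P PV; rewrite -nb_triples_preim_val.
have := IH {x in P} (preim3 val h); rewrite card_sig; apply=> //.
- exact: symmetric3_preim.
- exact: irreflexive3_preim.
exact: locally_tripartite_preim val_inj hK.
Qed.

Lemma density3_remove_vertex (R : realFieldType) d : symmetric3 h ->
  density3 R h <= density3 R (fun x y z => [&& x != d, y != d, z != d & h x y z]) +
    3 * (density2 R (h d) / #|V|%:R).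
Proof.
move=> hS; pose at_d x y z := (x == d) && h d y z.
have at_dE : density3 R at_d = density2 R (h d) / #|V|%:R.
  by rewrite (density3_prodl _ (pred1 d)) density_pred1 mulrC.
have at_d3 := density3_leU3 R (fun x y z => id : [|| at_d x y z, at_d y x z | at_d z x y] -> _).
rewrite (density3_swap R at_d) (density3_rotr R at_d) at_dE in at_d3.
have : density3 R h <= density3 R (fun x y z => [&& x != d, y != d, z != d & h x y z]) +
    density3 R (fun x y z => [|| at_d x y z, at_d y x z | at_d z x y]).
  apply: density3_leU => x y z xyz; rewrite /at_d.
  have [_ yxz _ zxy _] := symmetric3_perms hS xyz.
  case: (eqVneq x d) xyz yxz zxy => [->|xd] xyz yxz zxy; first by rewrite xyz orbT.
  case: (eqVneq y d) xyz yxz zxy => [->|yd] xyz yxz zxy; first by rewrite yxz orbT.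
  by case: (eqVneq z d) xyz yxz zxy => [->|zd] xyz yxz zxy; rewrite ?zxy ?xyz /= ?orbT.
lra.
Qed.

End CountTriples.

Lemma tripartition_cubic_bound (R : realFieldType) (a b c ta tb tc t : R) :
  0 <= a -> 0 <= b -> 0 <= c ->
  4 * ta <= a ^+ 3 + 24 * a ^+ 2 -> 4 * tb <= b ^+ 3 + 24 * b ^+ 2 ->
  4 * tc <= c ^+ 3 + 24 * c ^+ 2 -> t <= 6 * (a * b * c) + (ta + tb + tc) ->
  4 * t <= (a + b + c) ^+ 3 + 24 * (a + b + c) ^+ 2.
Proof.
move=> a0 b0 c0 hta htb htc ht.
have mulr_sqr_ge0 (u v : R) : 0 <= u -> 0 <= u * v ^+ 2 by move=> u0; rewrite mulr_ge0 ?sqr_ge0.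
have schur : 0 <= a * (b - c) ^+ 2 + b * (c - a) ^+ 2 + c * (a - b) ^+ 2.
  by rewrite !addr_ge0// mulr_sqr_ge0.
have pairs : 0 <= a * b + b * c + c * a by rewrite !addr_ge0 ?mulr_ge0.
have -> : (a + b + c) ^+ 3 + 24 * (a + b + c) ^+ 2 =
  (a ^+ 3 + 24 * a ^+ 2) + (b ^+ 3 + 24 * b ^+ 2) + (c ^+ 3 + 24 * c ^+ 2) + 24 * (a * b * c)
  + 3 * (a * (b - c) ^+ 2 + b * (c - a) ^+ 2 + c * (a - b) ^+ 2)
  + 48 * (a * b + b * c + c * a) by ring.
lra.
Qed.

Lemma cubic_bound_natr (R : realFieldType) (t n : nat) :
  (4 * t <= n ^ 3 + 24 * n ^ 2)%N = (4 * t%:R <= n%:R ^+ 3 + 24 * n%:R ^+ 2 :> R).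
Proof. by rewrite -(ler_nat R) natrD (natrM R 4) (natrM R 24) !natrX. Qed.

Section Induction.
Variables (R : realFieldType) (K D : nat) (V : finType) (h : V -> V -> V -> bool).
Hypothesis D_big : 1 < D%:R * (((1 / 50) ^+ 2) ^+ 4 / 24) ^+ 2 :> R.
Hypothesis DK : (3 * (7 * D + 10) <= K)%N.
Hypotheses (hS : symmetric3 h) (hI : irreflexive3 h) (hK : locally_tripartite h K).
Hypothesis V_gt0 : (0 < #|V|)%N.
Hypothesis restrict_le : forall P : {pred V}, (#|P| < #|V|)%N ->
  (4 * nb_triples (fun x y z => [&& x \in P, y \in P, z \in P & h x y z]) <=
   #|P| ^ 3 + 24 * #|P| ^ 2)%N.

Let n : R := #|V|%:R.
Let n_gt0 : 0 < n. Proof. by rewrite ltr0n. Qed.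

Let nb_triplesE (g : V -> V -> V -> bool) : (nb_triples g)%:R = density3 R g * n ^+ 3.
Proof. by rewrite density3_nb_triples divfK// gt_eqF ?exprn_gt0. Qed.

Lemma nb_triples_low_degree d : density2 R (h d) < 1 / 4 ->
  (4 * nb_triples h <= #|V| ^ 3 + 24 * #|V| ^ 2)%N.
Proof.
move=> low; have card_rest : #|predC1 d| = #|V|.-1 by rewrite cardC1.
have /restrict_le : (#|predC1 d| < #|V|)%N by rewrite card_rest prednK.
rewrite !(cubic_bound_natr R) card_rest -subn1 natrB// -/n !nb_triplesE.
have := density3_remove_vertex R d hS; rewrite -/n.
set total := density3 R h; set rest := density3 R _ => removed.
have n1 : 1 <= n by rewrite ler1n.
have : total * n ^+ 3 <= rest * n ^+ 3 + 3 * (density2 R (h d)) * n ^+ 2.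
  have -> : rest * n ^+ 3 + 3 * (density2 R (h d)) * n ^+ 2 =
    (rest + 3 * (density2 R (h d) / n)) * n ^+ 3 by field; rewrite gt_eqF.
  by rewrite ler_pM2r ?exprn_gt0.
have : density2 R (h d) * n ^+ 2 <= 1 / 4 * n ^+ 2 by rewrite ler_pM2r ?exprn_gt0// ltW.
move: n1; rewrite !expr2 !exprS expr0; nra.
Qed.

Lemma nb_triples_high_degree : (forall d, 1 / 4 <= density2 R (h d)) ->
  (4 * nb_triples h <= #|V| ^ 3 + 24 * #|V| ^ 2)%N.
Proof.
move=> min_degree.
have rho_gt0 : 0 < (1 / 50) ^+ 2 :> R by rewrite exprn_gt0.
have [part [part_nonempty bound]] :=
  exists_partition_bound rho_gt0 (lexx _) D_big DK hS hI hK V_gt0 min_degree.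
pose P i : {pred V} := [pred x | part x == i].
have densityE i : density R (fun x => part x == i) = #|P i|%:R / n by apply: density_card.
have card_V : (#|P 0%R| + #|P 1%R| + #|P (-1)%R| = #|V|)%N.
  rewrite -[RHS]sum1_card (partition_big part xpredT)//= (sum_Z3 _ 0) add0r sub0r.
  by congr (_ + _ + _)%N; rewrite -sum1_card; apply: eq_bigl => x.
have P_gt0 i : (0 < #|P i|)%N.
  by have [x xi] := part_nonempty i; apply/card_gt0P; exists x.
have P_lt i : (#|P i| < #|V|)%N.
  by have := (P_gt0 0, P_gt0 1, P_gt0 (-1)); rewrite -card_V; elim/Z3_ind: i => -[[]]; lia.
have restrict_leR i :
    4 * (nb_triples (inside h part i))%:R <= #|P i|%:R ^+ 3 + 24 * #|P i|%:R ^+ 2 :> R.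
  by rewrite -cubic_bound_natr; apply: restrict_le (P_lt i).
have main : (nb_triples h)%:R <= 6 * (#|P 0|%:R * #|P 1|%:R * #|P (-1)|%:R) +
    ((nb_triples (inside h part 0))%:R + (nb_triples (inside h part 1))%:R +
     (nb_triples (inside h part (-1)))%:R) :> R.
  move: bound; rewrite (sum_Z3 _ 0) add0r sub0r !densityE !nb_triplesE.
  have n3 : 0 < n ^+ 3 by rewrite exprn_gt0.
  rewrite -(ler_pM2r n3) => le; apply: le_trans le _.
  by rewrite le_eqVlt; apply/orP; left; apply/eqP; field; rewrite gt_eqF.
have := tripartition_cubic_bound (ler0n R _) (ler0n R _) (ler0n R _) (restrict_leR 0)
  (restrict_leR 1) (restrict_leR (-1)) main.
by rewrite -!natrD card_V -cubic_bound_natr.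
Qed.

End Induction.

Lemma exists_diameter_constant (R : archiRealFieldType) :
  exists D, 1 < D%:R * (((1 / 50) ^+ 2) ^+ 4 / 24) ^+ 2 :> R.
Proof.
set x : R := _ ^+ 2; have x_gt0 : 0 < x by rewrite !(exprn_gt0, divr_gt0).
exists (Num.bound x^-1).
by rewrite -ltr_pdivrMr// div1r; apply: archi_boundP; rewrite invr_ge0 ltW.
Qed.

Definition locally_tripartite_cubic_bound K := forall (V : finType) (h : V -> V -> V -> bool),
  symmetric3 h -> irreflexive3 h -> locally_tripartite h K ->
  (4 * nb_triples h <= #|V| ^ 3 + 24 * #|V| ^ 2)%N.

Theorem exists_locally_tripartite_cubic_bound : exists K, locally_tripartite_cubic_bound K.
Proof.
have [D D_big] := exists_diameter_constant rat.
exists (3 * (7 * D + 10))%N => V.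
have [m] := ubnP #|V|; elim: m V => // m IH V Vm h hS hI hK.
have [V0|V_gt0] := posnP #|V|.
  by rewrite /nb_triples eq_card0 ?muln0// => -[[x]]; case: (fintype0 x V0).
have restrict_le := @nb_triples_restrict_le V h _ (fun n => n ^ 3 + 24 * n ^ 2)%N
  (fun U g UV => IH U (leq_trans UV Vm) g) hS hI hK.
have [/existsP[d low]|/existsPn high] := boolP [exists d, density2 rat (h d) < 1 / 4].
  exact: nb_triples_low_degree hS V_gt0 restrict_le _ low.
apply: nb_triples_high_degree D_big (leqnn _) hS hI hK V_gt0 restrict_le _ => d.
by rewrite leNgt high.
Qed.

(** * Sampling *)

Section RandomTuple.
Variables (R : realFieldType) (V : finType).

Lemma avg_tuple_cons m (f : m.+1.-tuple V -> R) :
  avg f = avg (fun x => avg (fun t : m.-tuple V => f [tuple of x :: t])).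
Proof.
rewrite -avg_pair -(@avg_bij _ _ _ (fun p : V * m.-tuple V => [tuple of p.1 :: p.2]) f) //.
exists (fun t : m.+1.-tuple V => (thead t, [tuple of behead t])) => [[x t]|t] /=.
  by rewrite theadE; congr (_, _); apply: val_inj.
by rewrite [RHS]tuple_eta.
Qed.

Hypothesis V_gt0 : (0 < #|V|)%N.

Lemma avg_tuple_cst m a : avg (fun _ : m.-tuple V => a) = a :> R.
Proof. by rewrite avg_cst// card_tuple expn_gt0 V_gt0. Qed.

Lemma avg_tnth m (i : 'I_m) (f : V -> R) :
  avg (fun t : m.-tuple V => f (tnth t i)) = avg f.
Proof.
elim: m i => [[]//|m IH] i; rewrite avg_tuple_cons; case: (unliftP ord0 i) => [j|] ->.
  rewrite -[RHS](avg_cst (avg f) V_gt0); apply: eq_avg => x.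
  by under eq_avg do rewrite tnthS; apply: IH.
by apply: eq_avg => x; under eq_avg do rewrite tnth0; apply: avg_tuple_cst.
Qed.

Lemma avg_tnth2 m (i j : 'I_m) (f : V -> V -> R) : i != j ->
  avg (fun t : m.-tuple V => f (tnth t i) (tnth t j)) = avg (fun x => avg (f x)).
Proof.
elim: m i j => [[]//|m IH] i j; rewrite avg_tuple_cons.
case: (unliftP ord0 i) => [i'|] ->; case: (unliftP ord0 j) => [j'|] -> //.
- rewrite (inj_eq (@lift_inj _ _)) => ij; rewrite -[RHS](avg_cst _ V_gt0).
  by apply: eq_avg => x; under eq_avg do rewrite !tnthS; apply: IH.
- move=> _; rewrite [RHS]avg_swap; apply: eq_avg => x.
  by under eq_avg do rewrite tnthS tnth0; apply: (avg_tnth i' (f^~ x)).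
move=> _; apply: eq_avg => x.
by under eq_avg do rewrite tnthS tnth0; apply: (avg_tnth j' (f x)).
Qed.

Lemma avg_tnth3 m (i j k : 'I_m) (f : V -> V -> V -> R) : i != j -> j != k -> i != k ->
  avg (fun t : m.-tuple V => f (tnth t i) (tnth t j) (tnth t k)) =
  avg (fun x => avg (fun y => avg (f x y))).
Proof.
elim: m i j k => [[]//|m IH] i j k; rewrite avg_tuple_cons.
case: (unliftP ord0 i) => [i'|] ->; case: (unliftP ord0 j) => [j'|] ->;
  case: (unliftP ord0 k) => [k'|] -> //; rewrite ?(inj_eq (@lift_inj _ _)) => ij jk ik.
- rewrite -[RHS](avg_cst _ V_gt0); apply: eq_avg => x.
  by under eq_avg do rewrite !tnthS; apply: IH.
- under [RHS]eq_avg do rewrite avg_swap; rewrite [RHS]avg_swap; apply: eq_avg => z.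
  by under eq_avg do rewrite !tnthS tnth0; apply: (avg_tnth2 (fun x y => f x y z)).
- rewrite [RHS]avg_swap; apply: eq_avg => y.
  by under eq_avg do rewrite !tnthS tnth0; apply: (avg_tnth2 (fun x z => f x y z)).
apply: eq_avg => x.
by under eq_avg do rewrite !tnthS tnth0; apply: (avg_tnth2 (f x)).
Qed.

(* The sampled triples with three distinct indices have, on average, the density of [h]. *)
Lemma density3_sample_ge m (h : V -> V -> V -> bool) : (0 < m)%N ->
  density3 R h - 3 / m%:R <= avg (fun t : m.-tuple V => density3 R (preim3 (tnth t) h)).
Proof.
move=> m_gt0; pose distinct (i j k : 'I_m) := [&& i != j, j != k & i != k].
have coincide : density3 R (fun i j k => ~~ distinct i j k) <= 3 / m%:R.
  have I_gt0 : (0 < #|'I_m|)%N by rewrite card_ord.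
  have := density2_eq R 'I_m; rewrite card_ord => eqE.
  have : density3 R (fun i j k => ~~ distinct i j k) <= density3 R (fun i j _ : 'I_m => i == j) +
      density3 R (fun _ j k : 'I_m => j == k) + density3 R (fun i _ k : 'I_m => i == k).
    by apply: density3_leU3 => i j k; rewrite !negb_and !negbK.
  rewrite (density3_12 R I_gt0 eq_op) (density3_23 R I_gt0 eq_op) (density3_13 R I_gt0 eq_op) eqE.
  by lra.
rewrite avg_swap.
have : avg (fun p => density3 R h - (~~ distinct p.1.1 p.1.2 p.2)%:R) <=
    avg (fun p : 'I_m * 'I_m * 'I_m =>
      avg (fun t : m.-tuple V => (preim3 (tnth t) h p.1.1 p.1.2 p.2)%:R)).
  apply: le_avg => -[[i j] k] /=; case: (boolP (distinct i j k)) => [/and3P[ij jk ik]|_].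
    rewrite subr0 (avg_tnth3 (fun x y z => (h x y z)%:R) ij jk ik) density3E.
    by under eq_avg do rewrite density2E.
  by rewrite (le_trans _ (density_ge0 R _))// subr_le0; apply: density_le1.
apply: le_trans; rewrite avgB avg_cst ?card_prod ?card_ord ?muln_gt0 ?m_gt0//.
by rewrite lerD2l lerN2.
Qed.

End RandomTuple.

(* Double counting: the elements of [Q] true at [t] number at least [l] for a proportion [c / 2] of
   the [t]; then pigeonhole over the subsets of [Q]. *)
Lemma exists_popular_subset (R : realFieldType) (V T : finType) (Q : {set V}) (P : V -> pred T)
    (l : nat) (c : R) :
  0 < c -> (0 < #|Q|)%N -> 2 * l%:R <= c * #|Q|%:R ->
  (forall x, x \in Q -> c <= density R (P x)) ->
  exists2 B : {set V}, (l <= #|B|)%N &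
    c / 4 / 2 ^+ #|Q| <= density R (fun t => [forall x in B, P x t]).
Proof.
move=> c_gt0 Q_gt0 l_small P_big; have q_gt0 : 0 < #|Q|%:R :> R by rewrite ltr0n.
pose true_at t := [set x in Q | P x t].
have many : c / 2 <= density R (fun t => (l <= #|true_at t|)%N).
  have cardE t : #|true_at t|%:R = \sum_(x in Q) (P x t)%:R :> R.
    rewrite -natr_sum -sum1_card big_mkcond [in RHS]big_mkcond; congr _%:R.
    by apply: eq_bigr => x _; rewrite inE; case: (x \in Q) => //; case: (P x t).
  have low : c * #|Q|%:R <= avg (fun t => #|true_at t|%:R : R).
    under eq_avg do rewrite cardE; rewrite avg_sum mulr_natr -sumr_const.
    exact: ler_sum.
  have high : avg (fun t => #|true_at t|%:R : R) <=
      avg (fun t => #|Q|%:R * (l <= #|true_at t|)%:R + l%:R : R).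
    apply: le_avg => t; case: leqP => [_|/ltnW lt]; last by rewrite mulr0 add0r ler_nat.
    rewrite mulr1 -[leLHS]addr0 lerD ?ler0n// ler_nat subset_leq_card//.
    by apply/fintype.subsetP => x; rewrite inE => /andP[].
  move: high; rewrite avgD avgZl -/(density R _) => high.
  have avg_l : avg (fun _ : T => l%:R : R) <= l%:R by apply: avg_le.
  by rewrite -(ler_pM2l q_gt0); move: low high avg_l l_small; lra.
apply: contrapT => none.
pose c' := c / 4 / 2 ^+ #|Q|; have c'_ge0 : 0 <= c' by rewrite !divr_ge0 ?exprn_ge0 ?ltW.
have : density R (fun t => (l <= #|true_at t|)%N) <= \sum_(B in powerset Q) c'.
  apply: le_trans (density_le_bigU R (I := {set V}) (A := mem (powerset Q))
    (Q := fun B t => (l <= #|B|)%N && [forall x in B, P x t]) _) _.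
    move=> t lt; exists (true_at t).
      by rewrite inE powersetE; apply/fintype.subsetP => x; rewrite inE => /andP[].
    by rewrite lt; apply/forall_inP => x; rewrite inE => /andP[].
  apply: ler_sum => B _; case: (leqP l #|B|) => lB /=; last by rewrite density_pred0.
  by rewrite leNgt; apply/negP => /ltW B_big; apply: none; exists B.
rewrite sumr_const card_powerset -[c' *+ _]mulr_natr natrX /c' divfK ?gt_eqF ?exprn_gt0//.
by move: many; lra.
Qed.

(* P. Erdős, On extremal problems of graphs and generalized graphs, Israel J. Math. 2 (1964). *)
Theorem erdos_box (R : archiRealFieldType) (l m : nat) (c : R) : 0 < c ->
  exists n0 : nat, forall V : finType, (n0 <= #|V|)%N -> forall S : pred (m.-tuple V),
  c <= density R S -> exists A : 'I_m -> {set V}, (forall i, (l <= #|A i|)%N) /\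
    forall t : m.-tuple V, (forall i, tnth t i \in A i) -> S t.
Proof.
elim: m c => [|m IH] c c_gt0.
  exists 0%N => V _ S cS; exists (fun=> finset.set0); split=> [[]//|t _].
  have [t' St'] := density_gt0 (lt_le_trans c_gt0 cS).
  by rewrite (_ : t = t')// [t]tuple0 [t']tuple0.
have [q q_big] : exists q : nat, 4 * l%:R / c < q%:R.
  by eexists; exact: unstable.ltr_bound.
have q_gt0 : 0 < q%:R :> R by apply: le_lt_trans q_big; rewrite divr_ge0 ?mulr_ge0 ?ler0n ?ltW.
rewrite ltr_pdivrMr// in q_big.
have [|n1 IH1] := IH (c / 2 / 4 / 2 ^+ q); first by rewrite !divr_gt0// exprn_gt0.
have [n2 n2_big] : exists n : nat, 2 * q%:R / c < n%:R.
  by eexists; exact: unstable.ltr_bound.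
rewrite ltr_pdivrMr// in n2_big.
exists (maxn n1 n2) => V; rewrite geq_max => /andP[Vn1 Vn2] S cS.
pose fiber x := density R (fun t : m.-tuple V => S [tuple of x :: t]).
pose X := [set x | c / 2 <= fiber x].
have qX : (q <= #|X|)%N.
  have V_gt0 : 0 < #|V|%:R :> R.
    rewrite -(pmulr_lgt0 _ c_gt0); apply: lt_le_trans (_ : n2%:R * c <= _).
      by apply: lt_trans n2_big; rewrite mulr_gt0.
    by rewrite ler_pM2r// ler_nat.
  have : c / 2 <= density R (fun x => c / 2 <= fiber x).
    apply: density_above_half_avg (ltW c_gt0) _ => [x|]; first exact: density_le1.
    by rewrite /fiber -(avg_tuple_cons (fun t => (S t)%:R)).
  rewrite density_card (_ : #|_| = #|X|); last by apply: eq_card => x; rewrite !inE.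
  rewrite ler_pdivlMr// -(ler_nat R).
  have : n2%:R * c <= #|V|%:R * c by rewrite ler_pM2r// ler_nat.
  by move: n2_big; lra.
have /card_geqP[s [s_uniq s_size sX]] := qX.
have Q_card : #|[set x in s]| = q by rewrite cardsE (card_uniqP s_uniq).
have [|||x|B lB B_big] := @exists_popular_subset R V _ [set x in s]
  (fun x (t : m.-tuple V) => S [tuple of x :: t]) l (c / 2).
- by rewrite divr_gt0.
- by rewrite Q_card -(ltr_nat R).
- by rewrite Q_card; lra.
- by rewrite inE => /sX; rewrite inE.
rewrite Q_card in B_big; have [A [lA A_box]] := IH1 V Vn1 _ B_big.
exists (fun i => if unlift ord0 i is Some j then A j else B); split=> [i|t].
  by case: unliftP.
case/tupleP: t => x t tA; have /A_box/forall_inP box_t i : tnth t i \in A i.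
  by have := tA (lift ord0 i); rewrite tnthS liftK.
by apply: box_t; have := tA ord0; rewrite tnth0 unlift_none.
Qed.

Lemma exists_distinct_representatives (V : finType) l (A : 'I_l -> {set V}) :
  (forall i, (l <= #|A i|)%N) -> exists u : 'I_l -> V, injective u /\ forall i, u i \in A i.
Proof.
elim: l A => [A _|l IH A lA].
  have /choice[u uA] (i : 'I_0) : exists x, x \in A i by case: i.
  by exists u; split=> [[]|].
have [x xA] : exists x, x \in A ord0 by apply/card_gt0P; apply: leq_trans (lA ord0).
have [|u [u_inj uA]] := IH (fun j => A (lift ord0 j) :\ x).
  move=> j; have := lA (lift ord0 j); rewrite (cardsD1 x); case: (x \in _) => //.
  by rewrite add0n => /ltnW.
have ux j : u j != x by have := uA j; rewrite !inE => /andP[].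
exists (fun i => if unlift ord0 i is Some j then u j else x); split=> [i k|i]; last first.
  by case: unliftP => [j|] ->//; have := uA j; rewrite !inE => /andP[].
case: unliftP => [j|] ->; case: unliftP => [j'|] -> //.
- by move=> /u_inj ->.
- by move=> E; have := ux j; rewrite E eqxx.
by move=> E; have := ux j'; rewrite E eqxx.
Qed.

Section CycleMinusHom.
Variable l : nat.

(* The missing edge [{l - 1, 0, 1}] of the cycle is the one starting at [l - 1]. *)
Definition cycle_minus_hom (W : Type) (h : W -> W -> W -> bool) (u : 'I_l -> W) :=
  [forall i : 'I_l, (i < l.-1)%N ==> h (u i) (u (ordS i)) (u (ordS (ordS i)))].

Definition cycle_minus_copy (W : Type) (h : W -> W -> W -> bool) :=
  exists u : 'I_l -> W, injective u /\ cycle_minus_hom h u.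

Lemma closed_walk_hom (V : finType) (h : V -> V -> V -> bool) : (1 < l)%N ->
  closed_walk h l -> exists u, cycle_minus_hom h u.
Proof.
move=> l1 [x [y [z /walk_fun[g [g0 g1 gk gl gh]]]]]; exists (fun i => g i).
apply/forallP => i; apply/implyP => il; have := gh i il => /=.
rewrite (modn_small (_ : i.+1 < l)%N); last by lia.
have [E|E] := eqVneq i.+2 l; first by rewrite E modnn g0 -gl prednK// ltnW.
by rewrite modn_small//; lia.
Qed.

(* All transversals of the [A i] being homomorphic images of the cycle, choosing distinct vertices
   in the sets of its vertices gives an injective homomorphism. *)
Lemma box_cycle_minus_copy (V : finType) (h : V -> V -> V -> bool) m (A : 'I_m -> {set V})
    (g : 'I_l -> 'I_m) : symmetric3 h -> irreflexive3 h -> (0 < l)%N ->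
  (forall i, (l <= #|A i|)%N) ->
  (forall t : m.-tuple V, (forall i, tnth t i \in A i) -> cycle_minus_hom (preim3 (tnth t) h) g) ->
  cycle_minus_copy h.
Proof.
move=> hS hI l_gt0 lA box.
have [u [u_inj uA]] := exists_distinct_representatives (fun a => lA (g a)).
have [v vA] : exists v : 'I_m -> V, forall i, v i \in A i.
  have /choice[v vA] i : exists x, x \in A i by apply/card_gt0P; apply: leq_trans (lA i).
  by exists v.
pose f a b c i := if i == g a then u a else if i == g b then u b
  else if i == g c then u c else v i.
have fA a b c i : tnth (mktuple (f a b c)) i \in A i.
  by rewrite tnth_mktuple /f; do 3!case: eqP => [->//|_].
exists u; split=> //; apply/forallP => i; apply/implyP => il.
have /forallP/(_ i) := box _ (fA i (ordS i) (ordS (ordS i))); rewrite il /preim3 !tnth_mktuple.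
rewrite /= => edge; have [gab gbc gac] := irreflexive3_neqs hS hI edge.
have {}gab : g (ordS i) != g i by apply: contraNneq gab => ->.
have {}gbc : g (ordS (ordS i)) != g (ordS i) by apply: contraNneq gbc => ->.
have {}gac : g (ordS (ordS i)) != g i by apply: contraNneq gac => ->.
by move: edge; rewrite /f !eqxx (negbTE gab) (negbTE gbc) (negbTE gac).
Qed.

End CycleMinusHom.

Lemma density3_le_cubic (R : realFieldType) (V : finType) (h : V -> V -> V -> bool) :
  (0 < #|V|)%N -> (4 * nb_triples h <= #|V| ^ 3 + 24 * #|V| ^ 2)%N ->
  density3 R h <= 1 / 4 + 6 / #|V|%:R.
Proof.
move=> V_gt0; rewrite (cubic_bound_natr R) density3_nb_triples.
have n_gt0 : 0 < #|V|%:R :> R by rewrite ltr0n.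
rewrite ler_pdivrMr ?exprn_gt0// => le.
have -> : (1 / 4 + 6 / #|V|%:R) * #|V|%:R ^+ 3 = (#|V|%:R ^+ 3 + 24 * #|V|%:R ^+ 2) / 4 :> R.
  by field; rewrite gt_eqF.
by rewrite ler_pdivlMr// mulrC.
Qed.

Section CycleMinusFree.
Variables (R : archiRealFieldType) (K l : nat).
Hypothesis bound : locally_tripartite_cubic_bound K.
Hypotheses (l3 : ~~ (3 %| l)%N) (lK : (2 * K + 4 <= l)%N).

Let l_gt1 : (1 < l)%N. Proof. by lia. Qed.

Lemma density3_no_hom_le (W : finType) (h : W -> W -> W -> bool) : (0 < #|W|)%N ->
  symmetric3 h -> irreflexive3 h ->
  density3 R h <= 1 / 4 + 6 / #|W|%:R + [exists g : {ffun 'I_l -> W}, cycle_minus_hom h g]%:R.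
Proof.
move=> W_gt0 hS hI.
case: (boolP [exists g : {ffun 'I_l -> W}, cycle_minus_hom h g]) => [_|/existsPn no_hom].
  by apply: le_trans (density_le1 _ _) _; rewrite lerDr addr_ge0 ?divr_ge0.
rewrite addr0; apply: density3_le_cubic W_gt0 (bound hS hI _).
apply: (locally_tripartite_of_no_closed_walk hS hI l3 lK) => /(closed_walk_hom l_gt1)[u hu].
have /negP := no_hom (finfun u); apply; apply/forallP => i; rewrite !ffunE.
exact: (forallP hu).
Qed.

Lemma sampled_hom_rare m (c : R) : 0 < c ->
  exists n0 : nat, forall (V : finType) (h : V -> V -> V -> bool), (n0 <= #|V|)%N ->
  symmetric3 h -> irreflexive3 h -> ~ cycle_minus_copy l h -> forall g : 'I_l -> 'I_m,
  density R (fun t : m.-tuple V => cycle_minus_hom (preim3 (tnth t) h) g) <= c.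
Proof.
move=> c_gt0; have [n0 box] := @erdos_box R l m c c_gt0; exists n0 => V h Vn hS hI no g.
rewrite leNgt; apply/negP => /ltW dense; have [A [lA A_box]] := box V Vn _ dense.
exact/no/(box_cycle_minus_copy hS hI (ltnW l_gt1) lA A_box).
Qed.

Theorem cycle_minus_free_density (eps : R) : 0 < eps ->
  exists n0 : nat, forall (V : finType) (h : V -> V -> V -> bool), (n0 <= #|V|)%N ->
  symmetric3 h -> irreflexive3 h -> ~ cycle_minus_copy l h -> density3 R h <= 1 / 4 + eps.
Proof.
move=> eps_gt0.
have [m m_big] : exists m : nat, 18 / eps < m%:R.
  by eexists; exact: unstable.ltr_bound.
have mR_gt0 : 0 < m%:R :> R by apply: lt_trans m_big; rewrite divr_gt0.
have m_gt0 : (0 < m)%N by rewrite -(ltr_nat R).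
pose G := {ffun 'I_l -> 'I_m}; pose c : R := eps / 2 / (#|G|%:R + 1).
have G1 : 0 < #|G|%:R + 1 :> R by rewrite ltr_wpDl.
have c_gt0 : 0 < c by rewrite !divr_gt0.
have [n0 rare] := sampled_hom_rare m c_gt0.
exists (maxn n0 1) => V h; rewrite geq_max => /andP[Vn V_gt0] hS hI no.
have := density3_sample_ge R V_gt0 h m_gt0.
have : avg (fun t : m.-tuple V => density3 R (preim3 (tnth t) h)) <= 1 / 4 + 6 / m%:R +
    density R (fun t : m.-tuple V => [exists g : G, cycle_minus_hom (preim3 (tnth t) h) g]).
  rewrite -(avg_tuple_cst V_gt0 m (1 / 4 + 6 / m%:R)) -avgD; apply: le_avg => t.
  have := @density3_no_hom_le 'I_m (preim3 (tnth t) h); rewrite card_ord; apply=> //.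
    exact: symmetric3_preim.
  exact: irreflexive3_preim.
have : density R (fun t : m.-tuple V => [exists g : G, cycle_minus_hom (preim3 (tnth t) h) g]) <=
    \sum_(g : G) c.
  apply: le_trans (density_le_bigU R (A := predT) (Q := fun (g : G) (t : m.-tuple V) =>
    cycle_minus_hom (preim3 (tnth t) h) g) _) _; first by move=> t /existsP[g]; exists g.
  by apply: ler_sum => g _; apply: rare.
have : \sum_(g : G) c <= eps / 2.
  by rewrite sumr_const -[c *+ _]mulr_natl /c mulrCA ger_pMr ?divr_gt0// ler_pdivrMr// mul1r lerDl.
have : 18 / m%:R <= eps by rewrite ler_pdivrMr// mulrC -ler_pdivrMr// ltW.
by set x := m%:R^-1; lra.
Qed.

End CycleMinusFree.

(** * 3-graphs and their edge relations *)

Section EdgeRelation.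
Variable V : finType.
Implicit Type E : {set {set V}}.

Definition edge_rel E x y z := [set x; y; z] \in E.

Lemma set3_swap (x y z : V) : [set x; y; z] = [set y; x; z].
Proof. by rewrite (finset.setUC [set x]). Qed.

Lemma set3_rot (x y z : V) : [set x; y; z] = [set y; z; x].
Proof. by rewrite -finset.setUA finset.setUC. Qed.

Lemma symmetric3_edge_rel E : symmetric3 (edge_rel E).
Proof. by split=> x y z; rewrite /edge_rel; [rewrite set3_swap | rewrite set3_rot]. Qed.

Lemma irreflexive3_edge_rel E : uniform3 E -> irreflexive3 (edge_rel E).
Proof.
move=> /forall_inP u x z; apply/negP => /u; rewrite finset.setUid cards2.
by case: (x == z).
Qed.

Lemma card_orderings_ge (e : {set V}) : #|e| = 3 ->
  (6 <= #|[pred t : V * V * V | [set t.1.1; t.1.2; t.2] == e]|)%N.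
Proof.
move=> e3; have [a ae] : exists a, a \in e by apply/card_gt0P; rewrite e3.
have /eqP/cards2P[b [c [bc ea]]] : #|e :\ a| = 2 by move: e3; rewrite (cardsD1 a) ae => -[].
have ab : a != b.
  by have := set21 b c; rewrite -ea !inE eq_sym => /andP[].
have ac : a != c.
  by have := set22 b c; rewrite -ea !inE eq_sym => /andP[].
have {ea}eE : e = [set a; b; c] by rewrite -(finset.setD1K ae) ea finset.setUA.
apply/card_geqP; exists [:: (a, b, c); (a, c, b); (b, a, c); (b, c, a); (c, a, b); (c, b, a)].
split=> //.
  rewrite /= !inE !xpair_eqE !eqxx (negbTE ab) (negbTE ac) (negbTE bc).
  by rewrite (eq_sym b a) (eq_sym c a) (eq_sym c b) (negbTE ab) (negbTE ac) (negbTE bc).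
move=> t; rewrite !inE eE.
by do 5?case/orP; move/eqP=> -> /=; apply/eqP/setP => x; rewrite !inE; do 3!case: eqP.
Qed.

Lemma nb_triples_edge_rel E : uniform3 E -> (6 * #|E| <= nb_triples (edge_rel E))%N.
Proof.
move=> /forall_inP u; rewrite /nb_triples -[leqRHS]sum1_card.
rewrite (partition_big (fun t => [set t.1.1; t.1.2; t.2]) (mem E)) => [|t //] /=.
rewrite mulnC -sum_nat_const; apply: leq_sum => e eE.
apply: leq_trans (card_orderings_ge (eqP (u e eE))) _.
rewrite -sum1_card leq_eqVlt; apply/orP; left; apply/eqP; apply: eq_bigl => t.
by rewrite !inE /edge_rel andbC; case: eqP => // ->; rewrite eE.
Qed.

End EdgeRelation.

Lemma imset_set3 (V W : finType) (f : V -> W) a b c :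
  f @: [set a; b; c] = [set f a; f b; f c].
Proof. by rewrite !imsetU !imset_set1. Qed.

Definition singleton_family (V : finType) (F : graph3 V) : family3 :=
  fun G => G = existT graph3 V F.

Lemma family_free_singleton (V W : finType) (F : graph3 W) (H : graph3 V) :
  family_free (singleton_family F) H <-> ~ contains H F.
Proof. by split=> [free|no G ->]; [apply: (free _ erefl) | ]. Qed.

Lemma leq_card_edges_ex (Fs : family3) (V : finType) (H : graph3 V) :
  family_free Fs H -> (#|edges H| <= ex #|V| Fs)%N.
Proof.
case: H => E uE free; rewrite /edges /=.
pose E' : {set {set 'I_#|V|}} := [set enum_rank @: (e : {set V}) | e in E].
have uE' : uniform3 E'.
  apply/forall_inP => e /imsetP[e0 e0E ->]; rewrite card_imset; last exact: enum_rank_inj.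
  by have /forall_inP := uE; apply.
have <- : #|E'| = #|E| by rewrite card_imset//; apply: imset_inj; apply: enum_rank_inj.
apply: (@leq_bigmax_cond _ _ (fun K : graph3 'I_#|V| => #|edges K|) (exist _ E' uE')).
apply/asboolP => F FsF [f [f_inj fE]]; apply: (free F FsF).
exists (enum_val \o f); split; first by move=> x y /= /enum_val_inj /f_inj.
move=> e /fE /imsetP[e0 e0E Ee]; rewrite (imset_comp enum_val f) Ee -imset_comp.
rewrite (_ : _ @: _ = e0)//; apply/setP => x; apply/imsetP/idP => [[y ye ->]|xe].
  by rewrite /= enum_rankK.
by exists x; rewrite //= enum_rankK.
Qed.

(** * The lower bound *)

Section Unroll.
Variables (W : Type) (l : nat) (l_gt0 : (0 < l)%N) (u : 'I_l -> W).

Definition unroll (i : nat) : W := u (Ordinal (ltn_pmod i l_gt0)).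

Lemma unroll_ord (i : 'I_l) : unroll i = u i.
Proof. by congr u; apply: val_inj; rewrite /= modn_small. Qed.

Lemma unroll_period : unroll l = unroll 0.
Proof. by congr u; apply: val_inj; rewrite /= modnn mod0n. Qed.

Lemma cycle_minus_homP (h : W -> W -> W -> bool) :
  reflect (forall i, (i < l.-1)%N -> h (unroll i) (unroll i.+1) (unroll i.+2))
    (cycle_minus_hom h u).
Proof.
have ordS_unroll (i : 'I_l) : u (ordS i) = unroll i.+1 by congr u; apply: val_inj.
have ordSS_unroll (i : 'I_l) : u (ordS (ordS i)) = unroll i.+2.
  by congr u; apply: val_inj; rewrite /= -addn1 modnDml addn1.
apply: (iffP forall_inP) => hu i il.
  have il' : (i < l)%N := leq_trans il (leq_pred l).
  by have := hu (Ordinal il') il; rewrite ordS_unroll ordSS_unroll -unroll_ord.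
by rewrite ordS_unroll ordSS_unroll -unroll_ord; apply: hu.
Qed.

End Unroll.

Section ColourWindows.
Variables (c : nat -> 'Z_3) (N : nat).

Definition rainbow_window i := [&& c i != c i.+1, c i.+1 != c i.+2 & c i != c i.+2].

Definition constant_window i := (c i == c i.+1) && (c i.+1 == c i.+2).

Hypothesis windows : forall i, (i < N)%N -> rainbow_window i || constant_window i.

Lemma rainbow_windows : rainbow_window 0 -> forall i, (i < N)%N -> rainbow_window i.
Proof.
move=> rainbow0; elim=> // i IH iN; have /and3P[_ ne _] := IH (ltnW iN).
by case/orP: (windows iN) => // /andP[/eqP E _]; rewrite E eqxx in ne.
Qed.

Lemma constant_windows : constant_window 0 -> forall i, (i < N)%N -> constant_window i.
Proof.
move=> constant0; elim=> // i IH iN; have /andP[_ E] := IH (ltnW iN).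
by case/orP: (windows iN) => // /and3P[]; rewrite E.
Qed.

Lemma rainbow_period : rainbow_window 0 ->
  forall k r, (3 * k + r <= N.+1)%N -> c (3 * k + r) = c r.
Proof.
move=> rainbow0; have rainbow := rainbow_windows rainbow0.
have period i : (i.+1 < N)%N -> c i.+3 = c i.
  move=> iN; have /and3P[i01 i12 i02] := rainbow i (ltnW iN).
  have /and3P[_ i23 i13] := rainbow i.+1 iN.
  apply/eqP; move: i01 i12 i02 i23 i13.
  by elim/Z3_ind: (c i); elim/Z3_ind: (c i.+1); elim/Z3_ind: (c i.+2); elim/Z3_ind: (c i.+3).
elim=> [//|k IH] r kN.
have -> : (3 * k.+1 + r = (3 * k + r).+3)%N by lia.
by rewrite period ?IH//; lia.
Qed.

Lemma constant_colour : constant_window 0 -> forall i, (i < N.+1)%N -> c i = c 0.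
Proof.
move=> constant0; have constant := constant_windows constant0.
by elim=> // i IH iN; have /andP[/eqP <- _] := constant i iN; apply: IH (ltnW iN).
Qed.

End ColourWindows.

Section CycleMinus.
Variables (l : nat) (hl : (4 <= l)%N).

Lemma tight_cycle_minus_edge (i : 'I_l) : (i < l.-1)%N ->
  [set i; ordS i; ordS (ordS i)] \in tight_cycle_minus_edges l.
Proof.
move=> il; rewrite !inE; apply/andP; split; last by apply/imsetP; exists i.
have l2 : (2 < l)%N by lia.
apply/negP => /eqP/setP E.
have [i0|[i1|i2]] : i = 0 :> nat \/ (i = 1 :> nat \/ (1 < i)%N) by clear; lia.
- have := E (Ordinal l2); rewrite !inE -!val_eqE /= i0 (modn_small (ltnW l2)) (modn_small l2) /=.
  by clear -hl; lia.
- have := E (Ordinal l2); rewrite !inE -!val_eqE /= i1 (modn_small l2) /=.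
  by clear -hl; lia.
have := E i; rewrite !inE eqxx /=; by clear -hl il i2; lia.
Qed.

Lemma contains_tight_cycle_minus (V : finType) (H : graph3 V) :
  contains H (tight_cycle_minus hl) <-> cycle_minus_copy l (edge_rel (edges H)).
Proof.
split=> [[f [f_inj fE]]|[u [u_inj /forallP hu]]].
  exists f; split=> //; apply/forallP => i; apply/implyP => il.
  by rewrite /edge_rel -imset_set3; apply: fE; apply: tight_cycle_minus_edge.
exists u; split=> // e; rewrite !inE => /andP[ne /imsetP[i _ ei]].
have [il|il] := ltnP i l.-1.
  by have := hu i; rewrite il ei imset_set3.
case/negP: ne; rewrite ei; apply/eqP/setP => x; rewrite !inE -!val_eqE /=.
have -> : i = l.-1 :> nat by have := ltn_ord i; clear -il hl; lia.
rewrite prednK ?modnn; last by clear -hl; lia.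
by rewrite modn_small ?orbA//; clear -hl; lia.
Qed.

End CycleMinus.

Section TriplePower.
Variables (V : finType) (H : graph3 V).
Local Notation E := (edges H).
Local Notation W := ('Z_3 * V)%type.

Definition cross_edge (t : V * V * V) : {set W} := [set (0, t.1.1); (1, t.1.2); (-1, t.2)].

Definition copy_edge (p : 'Z_3 * {set V}) : {set W} := pair p.1 @: p.2.

Definition cross_edges : {set {set W}} := [set cross_edge t | t : V * V * V].

Definition copy_edges : {set {set W}} :=
  [set copy_edge p | p in finset.setX [set: 'Z_3] E].

Let card_edge (e : {set V}) : e \in E -> #|e| = 3.
Proof. by move=> eE; apply/eqP; have /forall_inP := svalP H; apply. Qed.

Let pair_inj (i : 'Z_3) : injective (pair i : V -> W).
Proof. by move=> x y []. Qed.

Lemma uniform3_triple_power : uniform3 (cross_edges :|: copy_edges).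
Proof.
apply/forall_inP => e /setUP[/imsetP[t _ ->]|/imsetP[[i f]]].
  by rewrite /cross_edge -finset.setUA !cardsU1 cards1 !inE !xpair_eqE.
by rewrite inE /= => /andP[_ /card_edge f3] ->; rewrite card_imset ?f3//; apply: pair_inj.
Qed.

Definition triple_power : graph3 W := exist _ (cross_edges :|: copy_edges) uniform3_triple_power.

Lemma card_cross_edges : #|cross_edges| = (#|V| ^ 3)%N.
Proof.
rewrite card_imset; first by rewrite !card_prod !expnS expn0 muln1 mulnA.
move=> [[x y] z] [[x' y'] z'] /setP eq.
have := eq (0, x); have := eq (1, y); have := eq (-1, z).
rewrite !inE !xpair_eqE /= !eqxx /= ?orbF ?orbT /=.
by move=> /esym/eqP-> /esym/eqP-> /esym/eqP->.
Qed.

Lemma card_copy_edges : #|copy_edges| = (3 * #|E|)%N.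
Proof.
rewrite card_in_imset; first by rewrite cardsX cardsT card_ord.
move=> [i f] [j g]; rewrite !inE /= => /card_edge f3 /card_edge g3 eq.
have [x xf] : exists x, x \in f by apply/card_gt0P; rewrite f3.
have : (i, x) \in copy_edge (j, g) by rewrite -eq; apply/imsetP; exists x.
by case/imsetP=> y _ /= [ij _]; move: eq; rewrite /copy_edge /= ij => /(imset_inj (@pair_inj _)) ->.
Qed.

Lemma card_triple_power : (#|V| ^ 3 + 3 * #|E| <= #|edges triple_power|)%N.
Proof.
rewrite /edges /= cardsU card_cross_edges card_copy_edges (_ : _ :&: _ = finset.set0).
  by rewrite cards0 subn0.
apply/setP => e; rewrite !inE; apply/negP => /andP[/imsetP[t _ ->] /imsetP[[i f] _ eq]].
have in0 : (0, t.1.1) \in cross_edge t by rewrite !inE eqxx.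
have in1 : (1, t.1.2) \in cross_edge t by rewrite !inE eqxx orbT.
rewrite eq in in0 in1; case/imsetP: in0 => x _ [i0 _]; case/imsetP: in1 => y _ [i1 _].
by have := etrans i0 (esym i1).
Qed.

Lemma triple_power_edge (p q r : W) : edge_rel (edges triple_power) p q r ->
  [&& p.1 != q.1, q.1 != r.1 & p.1 != r.1] \/
  [/\ p.1 = q.1, q.1 = r.1 & edge_rel E p.2 q.2 r.2].
Proof.
move=> pqr; have [pq qr pr] := irreflexive3_neqs (symmetric3_edge_rel _)
  (irreflexive3_edge_rel uniform3_triple_power) pqr.
move: pqr; rewrite /edge_rel /edges /= => /setUP[/imsetP[t _ eq]|/imsetP[[i f]]].
  left; have fst_neq (a b : W) : a \in cross_edge t -> b \in cross_edge t -> a != b -> a.1 != b.1.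
    by rewrite !inE => /orP[/orP[]|]/eqP-> /orP[/orP[]|]/eqP->; rewrite ?eqxx.
  have p_in : p \in cross_edge t by rewrite -eq !inE eqxx.
  have q_in : q \in cross_edge t by rewrite -eq !inE eqxx orbT.
  have r_in : r \in cross_edge t by rewrite -eq !inE eqxx !orbT.
  by rewrite !fst_neq.
rewrite inE /= => /andP[_ fE] eq; right.
have fstE a : a \in [set p; q; r] -> a.1 = i by rewrite eq => /imsetP[x _ ->].
rewrite !fstE ?inE ?eqxx ?orbT//; split=> //.
by rewrite /edge_rel -(imset_set3 snd) eq /copy_edge -imset_comp (eq_imset (g := id)) // imset_id.
Qed.

Lemma triple_power_free l : (3 < l)%N -> ~~ (3 %| l)%N ->
  ~ cycle_minus_copy l (edge_rel E) -> ~ cycle_minus_copy l (edge_rel (edges triple_power)).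
Proof.
move=> l_gt3 l3 no [u [u_inj hu]]; have l_gt0 : (0 < l)%N by lia.
pose w := unroll l_gt0 u; pose c i := (w i).1.
have {hu}edge i : (i < l.-1)%N -> edge_rel (edges triple_power) (w i) (w i.+1) (w i.+2).
  by move=> il; have /cycle_minus_homP := hu; apply.
have windows i : (i < l.-1)%N -> rainbow_window c i || constant_window c i.
  move=> /edge/triple_power_edge[rainbow|[E01 E12 _]]; first by rewrite /rainbow_window rainbow.
  by rewrite /constant_window /c E01 E12 !eqxx orbT.
have l1_gt0 : (0 < l.-1)%N by lia.
have [rainbow0|constant0] := orP (windows 0%N l1_gt0).
  have := rainbow_period windows rainbow0 (k := (l %/ 3)%N) (r := (l %% 3)%N).
  rewrite prednK// mulnC -divn_eq /c /w unroll_period => /(_ (leqnn _)).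
  case/and3P: rainbow0 => n01 _ n02.
  have : (l %% 3 = 1 \/ l %% 3 = 2)%N by lia.
  by case=> -> /eqP; [rewrite (negbTE n01) | rewrite (negbTE n02)].
have fst_u (i : 'I_l) : (u i).1 = c 0%N.
  by rewrite -(unroll_ord l_gt0); apply: (constant_colour windows constant0); rewrite prednK.
apply: no; exists (snd \o u); split.
  by move=> i j /= eq; apply: u_inj; apply/eqP; rewrite -pair_eqE /pair_eq !fst_u eq !eqxx.
apply/(cycle_minus_homP l_gt0) => i il.
have /triple_power_edge[/and3P[+ _ _]|[_ _]//] := edge i il.
by have /andP[/eqP E _] := constant_windows windows constant0 il; rewrite -/(c i) E eqxx.
Qed.

End TriplePower.

Lemma iterated_triple_power l k : (3 < l)%N -> ~~ (3 %| l)%N ->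
  exists (V : finType) (H : graph3 V), [/\ #|V| = (3 ^ k)%N,
    ~ cycle_minus_copy l (edge_rel (edges H)) & (27 ^ k <= 24 * #|edges H| + 3 ^ k)%N].
Proof.
move=> l_gt3 l3; elim: k => [|k [V [H [cV free many]]]].
  have u0 : uniform3 (finset.set0 : {set {set unit}}) by apply/forall_inP => e; rewrite inE.
  exists unit, (exist _ finset.set0 u0); split; first by rewrite card_unit.
    have l_gt0 : (0 < l)%N by lia.
    move=> [u [_ /(cycle_minus_homP l_gt0)/(_ 0%N)]].
    by rewrite /edge_rel inE ltn_predRL => /(_ (ltnW (ltnW l_gt3))).
  by rewrite expn0 leq_addl.
exists ('Z_3 * V)%type, (triple_power H); split.
- by rewrite card_prod card_ord cV expnS.
- exact: triple_power_free.
have E27 : ((3 ^ k) ^ 3 = 27 ^ k)%N by rewrite -expnM mulnC expnM.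
have := card_triple_power H; rewrite cV E27 !expnS.
by move: many; move: (27 ^ k)%N (3 ^ k)%N => x y; clear; lia.
Qed.

(** * The limit *)

Lemma bin3 n : ('C(n, 3) * 6 = n * (n - 1) * (n - 2))%N.
Proof.
have := bin_ffact n 3; rewrite (_ : 3`! = 6)%N// => ->.
by rewrite !ffactnSr ffactn0 mul1n subn0.
Qed.

Section TuranRatio.
Variables (R : realType) (l : nat) (hl : (4 <= l)%N).
Hypothesis l3 : ~~ (3 %| l)%N.
Local Notation ratio := (turan_ratio R (singleton_family (tight_cycle_minus hl))).

Lemma turan_ratio_ge k : 1 / 4 <= ratio (3 ^ k.+1)%N.
Proof.
have [V [H [cV free many]]] := iterated_triple_power k.+1 hl l3.
have : (#|edges H| <= ex #|V| (singleton_family (tight_cycle_minus hl)))%N.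
  by apply/leq_card_edges_ex/family_free_singleton => /contains_tight_cycle_minus.
rewrite cV /turan_ratio => ex_ge.
have n3 : (3 <= 3 ^ k.+1)%N by rewrite expnS leq_pmulr// expn_gt0.
rewrite ler_pdivlMr ?ltr0n ?bin_gt0//.
suff : ('C(3 ^ k.+1, 3) <= 4 * ex (3 ^ k.+1) (singleton_family (tight_cycle_minus hl)))%N.
  by rewrite -(ler_nat R) (natrM R 4); lra.
have := bin3 (3 ^ k.+1); have E27 : (27 ^ k.+1 = 3 ^ k.+1 * 3 ^ k.+1 * 3 ^ k.+1)%N.
  by rewrite -!expnMn.
move: many ex_ge n3; rewrite E27.
move: (3 ^ k.+1)%N 'C(_, _) (ex _ _) (#|_|) => n b e f many ex_ge n3 bE.
have : (n * (n - 1) * (n - 2) + n <= n * n * n)%N.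
  have [m ->] : exists m, n = m.+2 by exists n.-2; clear -n3; lia.
  by rewrite !subSS !subn0; nia.
by clear -many ex_ge bE; lia.
Qed.

Lemma cubic_le_falling (x y n : R) : 0 <= n -> 0 <= y -> 3 * y <= n * (y - x) ->
  x * n ^+ 3 <= y * (n * (n - 1) * (n - 2)).
Proof.
move=> n0 y0 le; rewrite -subr_ge0.
have -> : y * (n * (n - 1) * (n - 2)) - x * n ^+ 3 =
  n * (n * (n * (y - x) - 3 * y) + 2 * y) by ring.
by rewrite mulr_ge0// addr_ge0 ?mulr_ge0// subr_ge0.
Qed.

Lemma turan_ratio_le (x y : R) n : (3 <= n)%N -> 0 <= y -> 3 * y <= n%:R * (y - x) ->
  (forall H : graph3 'I_n, ~ contains H (tight_cycle_minus hl) ->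
    density3 R (edge_rel (edges H)) <= x) ->
  ratio n <= y.
Proof.
move=> n3 y0 le dens; have n_gt0 : 0 < n%:R :> R by rewrite ltr0n (leq_trans _ n3).
have xn : x * n%:R ^+ 3 <= y * ('C(n, 3)%:R * 6).
  apply: le_trans (cubic_le_falling (ltW n_gt0) y0 le) _.
  by rewrite -(natrM R _ 6) bin3 !natrM !natrB// (leq_trans _ n3).
rewrite /turan_ratio ler_pdivrMr ?ltr0n ?bin_gt0// /ex.
apply: (big_ind (fun k : nat => k%:R <= y * 'C(n, 3)%:R)).
- by rewrite mulr_ge0.
- by move=> a b ha hb; case: (leqP a b).
move=> H /asboolP/family_free_singleton/dens.
rewrite density3_nb_triples card_ord ler_pdivrMr ?exprn_gt0// => nb_le.
have := nb_triples_edge_rel (svalP H); rewrite -(ler_nat R) (natrM R 6) -/(edges H).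
by move: nb_le xn; lra.
Qed.

End TuranRatio.

Lemma limn_ge_frequently (R : realType) (u : R ^nat) (x : R) : cvgn u ->
  (forall N, exists2 n, (N <= n)%N & x <= u n) -> x <= limn u.
Proof.
move=> cvg_u often; rewrite leNgt; apply/negP => lt.
have [N _ below] := cvgr_lt _ cvg_u _ lt; have [n Nn] := often N.
by rewrite leNgt below.
Qed.

Lemma turan_density_le (R : realType) (K l : nat) (hl : (4 <= l)%N) :
  locally_tripartite_cubic_bound K -> ~~ (3 %| l)%N -> (2 * K + 4 <= l)%N ->
  turan_density R (tight_cycle_minus hl) <= 1 / 4.
Proof.
move=> bound l3 lK; apply/ler_addgt0Pr => eps eps_gt0.
have eps2 : 0 < eps / 2 by rewrite divr_gt0.
have [n0 free] := cycle_minus_free_density bound l3 lK eps2.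
have [n1 n1_big] : exists n : nat, 3 * (1 / 4 + eps) / (eps / 2) < n%:R.
  by eexists; exact: unstable.ltr_bound.
apply: limr_le; first exact: is_cvg_turan_ratio.
exists (maxn (maxn n0 n1) 3) => // n /=; rewrite !geq_max => /andP[/andP[n0n n1n] n3].
apply: (turan_ratio_le (x := 1 / 4 + eps / 2)) => //.
- by rewrite addr_ge0 ?divr_ge0 ?ltW.
- rewrite (_ : _ - _ = eps / 2); last by lra.
  by rewrite -ler_pdivrMr// (le_trans (ltW n1_big))// ler_nat.
move=> H /contains_tight_cycle_minus no; apply: free; rewrite ?card_ord//.
  exact: symmetric3_edge_rel.
exact: irreflexive3_edge_rel (svalP H).
Qed.

Theorem theorem1p1 (R : realType) :
  exists L : nat, forall (l : nat) (hl : (4 <= l)%N),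
    (L < l)%N -> ~~ (3 %| l)%N ->
    turan_density R (tight_cycle_minus hl) = 1 / 4.
Proof.
have [K bound] := exists_locally_tripartite_cubic_bound.
exists (2 * K + 4)%N => l hl lL l3; apply: le_anti; apply/andP; split.
  exact: turan_density_le bound l3 (ltnW lL).
apply: limn_ge_frequently; first exact: is_cvg_turan_ratio.
move=> N; exists (3 ^ N.+1)%N; last exact: turan_ratio_ge.
by rewrite ltnW// ltnW// ltn_expl.
Qed.
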